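(* Let $\mathfrak{g}_{2|4}^{1},\mathfrak{g}_{2|4}^{2},\mathfrak{g}_{2|4}^{3}(\lambda)$ ($\lambda\in\mathbb{C}$), $\mathfrak{g}_{2|4}^{4},\mathfrak{g}_{2|4}^{5}$ be the complex Lie superalgebras of dimension $2|4$ with basis $\{e_1,e_2\mid e_3,e_4,e_5,e_6\}$ ($e_1,e_2$ even, $e_3,\dots,e_6$ odd) and nontrivial brackets \begin{align*} \mathfrak{g}_{2|4}^{1}:\ &[e_2,e_4]=e_3,\ [e_2,e_5]=-e_6,\ [e_4,e_5]=e_1;\\ \mathfrak{g}_{2|4}^{2}:\ &[e_2,e_4]=e_4,\ [e_2,e_5]=e_3,\ [e_2,e_6]=-e_6,\ [e_5,e_5]=[e_4,e_6]=e_1;\\ \mathfrak{g}_{2|4}^{3}(\lambda):\ &[e_2,e_3]=e_3,\ [e_2,e_4]=\lambda e_4,\ [e_2,e_5]=-e_5,\ [e_2,e_6]=-\lambda e_6,\ [e_3,e_5]=e_1,\ [e_4,e_6]=\lambda e_1;\\ \mathfrak{g}_{2|4}^{4}:\ &[e_2,e_3]=e_3,\ [e_2,e_4]=e_3+e_4,\ [e_2,e_5]=-e_5-e_6,\ [e_2,e_6]=-e_6,\ [e_3,e_5]=[e_4,e_5]=[e_4,e_6]=e_1;\\ \mathfrak{g}_{2|4}^{5}:\ &[e_2,e_3]=e_5,\ [e_2,e_4]=e_3,\ [e_2,e_5]=-e_6,\ [e_3,e_3]=-e_1,\ [e_4,e_5]=e_1. \end{align*} Then $\mathfrak{g}_{2|4}^{1}$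 has jump metric deformations to $\mathfrak{g}_{2|2}^{2}\oplus\mathbb{C}_{0|2}$, $\mathfrak{g}_{2|4}^{2}$, $\mathfrak{g}_{2|4}^{3}(1)$, $\mathfrak{g}_{2|4}^{3}(\sqrt{-1})$, $\mathfrak{g}_{2|4}^{4}$, $\mathfrak{g}_{2|4}^{5}$, and it has smooth metric deformations to the family $\mathfrak{g}_{2|4}^{3}(\lambda)$ around $\lambda=0$, around $\lambda=1$ and around $\lambda=\sqrt{-1}$.
   Context: All Lie superalgebras are over $\mathbb{C}$. Brackets of basis elements that are not listed are zero or determined by $[y,x]=-(-1)^{|x||y|}[x,y]$. $\mathbb{C}_{m|n}$ is the abelian Lie superalgebra of dimension $m|n$. $\mathfrak{g}_{2|2}^{2}$ is the $2|2$-dimensional Lie superalgebra with basis $\{e_1,e_2\mid e_3,e_4\}$ and nontrivial brackets $[e_3,e_4]=e_1$, $[e_2,e_3]=e_3$, $[e_2,e_4]=-e_4$. A metric Lie superalgebra is a Lie superalgebra together with an even, non-degenerate, supersymmetric bilinear form $B$ that is invariant: $B([x,y],z)=B(x,[y,z])$. A formal 1-parameter deformation of a Lie superalgebra $(\mathfrak g,[\ ,\ ])$ is a $\mathbb{C}[[t]]$-bilinear Lie superalgebra structure on $\mathfrak g[[t]]=\mathfrak g\otimes_{\mathbb C}\mathbb{C}[[t]]$ of the form $[\ ,\ ]_t=[\ ,\ ]+\sum_{i\ge1}t^i\phi_i$, each $\phi_i:\mathfrak g\times\mathfrak g\to\mathfrak g$ being an even super-skew-symmetric bilinear map. A metric deformation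 is a formal 1-parameter deformation that defines a metric Lie superalgebra, i.e. $(\mathfrak g[[t]],[\ ,\ ]_t)$ admits an even, supersymmetric, invariant $\mathbb{C}[[t]]$-bilinear form that is non-degenerate over $\mathbb{C}[[t]]$ (induces an isomorphism with the dual module). A deformation is a jump deformation to $\mathfrak h$ if for every non-zero value of $t$ near the origin it gives an algebra isomorphic to the same Lie superalgebra $\mathfrak h$, which is not isomorphic to $\mathfrak g$. It is smooth if for different non-zero values of $t$ near the origin it defines non-isomorphic algebras (coincidences caused by symmetry being allowed). It is a smooth deformation to a family $\mathfrak h(\lambda)$ around $\lambda_0$ if it is smooth and for non-zero $t$ near the origin it is isomorphic to $\mathfrak h(\lambda(t))$ with $\lambda(t)\to\lambda_0$ as $t\to0$. *)

(* Defs.v *)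
From HB Require Import structures.
From mathcomp Require Import all_boot all_order all_algebra.
From mathcomp Require Import complex.
From mathcomp Require Import all_classical all_reals all_analysis.

Set Implicit Arguments.
Unset Strict Implicit.
Unset Printing Implicit Defensive.

Import Order.TTheory GRing.Theory Num.Theory.
Import numFieldNormedType.Exports.

Local Open Scope classical_set_scope.
Local Open Scope ring_scope.

(** ** The ring K[[t]] of formal power series *)

Record fps (K : comNzRingType) := Fps { fcoef : nat -> K }.

Section FpsRing.
Variable K : comNzRingType.

HB.instance Definition _ := [isNew for @fcoef K].
HB.instance Definition _ := [Choice of fps K by <:].

Lemma fpsP (a b : fps K) : fcoef a =1 fcoef b <-> a = b.
Proof.
split=> [|-> //]; case: a b => [a] [b] /= ab.
by congr Fps; apply/funext.
Qed.

Definition fps_zero := @Fps K (fun=> 0).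
Definition fps_opp (a : fps K) := Fps (fun n => - fcoef a n).
Definition fps_add (a b : fps K) := Fps (fun n => fcoef a n + fcoef b n).
Definition fps_one := @Fps K (fun n => (n == 0%N)%:R).
Definition fps_mul (a b : fps K) :=
  Fps (fun n => \sum_(i < n.+1) fcoef a i * fcoef b (n - i)).

Fact fps_addA : associative fps_add.
Proof. by move=> a b c; apply/fpsP => n; apply: addrA. Qed.
Fact fps_addC : commutative fps_add.
Proof. by move=> a b; apply/fpsP => n; apply: addrC. Qed.
Fact fps_add0 : left_id fps_zero fps_add.
Proof. by move=> a; apply/fpsP => n; apply: add0r. Qed.
Fact fps_addN : left_inverse fps_zero fps_opp fps_add.
Proof. by move=> a; apply/fpsP => n; apply: addNr. Qed.

HB.instance Definition _ :=
  GRing.isZmodule.Build (fps K) fps_addA fps_addC fps_add0 fps_addN.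

Let trunc N (a : fps K) := \poly_(i < N) fcoef a i.

Let fps_mul_trunc N a b n : (n < N)%N ->
  fcoef (fps_mul a b) n = (trunc N a * trunc N b)`_n.
Proof.
move=> nN; rewrite coefM; apply: eq_bigr => i _; rewrite !coef_poly.
by rewrite (leq_ltn_trans _ nN) ?leq_ord// (leq_ltn_trans (leq_subr _ _) nN).
Qed.

Fact fps_mulA : associative fps_mul.
Proof.
move=> a b c; apply/fpsP => n.
have := mulrA (trunc n.+1 a) (trunc n.+1 b) (trunc n.+1 c).
move/(congr1 (fun p : {poly K} => p`_n)); rewrite [LHS]coefM [RHS]coefM => e.
transitivity (\sum_(j < n.+1) (trunc n.+1 a)`_j *
  (trunc n.+1 b * trunc n.+1 c)`_(n - j)).
  apply: eq_bigr => i _.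
  by rewrite coef_poly ltn_ord (@fps_mul_trunc n.+1)// ltnS leq_subr.
rewrite e; apply: eq_bigr => i _.
by rewrite coef_poly ltnS leq_subr (@fps_mul_trunc n.+1).
Qed.

Fact fps_mulC : commutative fps_mul.
Proof.
move=> a b; apply/fpsP => n.
by rewrite !(@fps_mul_trunc n.+1)// mulrC.
Qed.

Fact fps_mul1 : left_id fps_one fps_mul.
Proof.
move=> a; apply/fpsP => n /=.
rewrite big_ord_recl /= subn0 mul1r big1 ?addr0// => i _.
by rewrite mul0r.
Qed.

Fact fps_mulDl : left_distributive fps_mul fps_add.
Proof.
move=> a b c; apply/fpsP => n /=; rewrite -big_split /=.
by apply: eq_bigr => i _; rewrite mulrDl.
Qed.

Fact fps_one_neq0 : fps_one != 0.
Proof.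
apply/eqP => /(congr1 (fun a => fcoef a 0)) /= /eqP.
by rewrite oner_eq0.
Qed.

HB.instance Definition _ := GRing.Zmodule_isComNzRing.Build (fps K)
  fps_mulA fps_mulC fps_mul1 fps_mulDl fps_one_neq0.

End FpsRing.

(** ** Superalgebras on a free module with a homogeneous basis *)

(* The underlying supermodule is K^d with its standard basis, whose i-th vector
   is odd iff [parity i]; [sc i j] is the bracket of the i-th and j-th basis
   vectors. *)
Record superalgebra (K : comNzRingType) (d : nat) := SuperAlgebra {
  parity : 'I_d -> bool;
  sc : 'I_d -> 'I_d -> 'rV[K]_d }.

Section Superalgebra.
Context {K : comNzRingType} {d : nat}.
Implicit Type g : superalgebra K d.

Definition bracket g (x y : 'rV[K]_d) : 'rV[K]_d :=
  \sum_i \sum_j (x 0 i * y 0 j) *: sc g i j.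

Definition homogeneous g (a : bool) (x : 'rV[K]_d) : Prop :=
  forall i, parity g i != a -> x 0 i = 0.

Definition lie_superalgebra g : Prop :=
  [/\ forall a b x y, homogeneous g a x -> homogeneous g b y ->
        homogeneous g (a (+) b) (bracket g x y),
      forall a b x y, homogeneous g a x -> homogeneous g b y ->
        bracket g y x = - (-1) ^+ (a && b) *: bracket g x y &
      forall a b x y z, homogeneous g a x -> homogeneous g b y ->
        bracket g x (bracket g y z) =
          bracket g (bracket g x y) z +
          (-1) ^+ (a && b) *: bracket g y (bracket g x z)].

(* Bilinear form with Gram matrix [B]. *)
Definition form (B : 'M[K]_d) (x y : 'rV[K]_d) : K := (x *m B *m y^T) 0 0.

(* In the last clause [x *m B] is the row of coordinates of the functional
   [form B x] in the dual basis. *)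
Definition invariant_metric g (B : 'M[K]_d) : Prop :=
  [/\ forall x y, homogeneous g false x -> homogeneous g true y ->
        form B x y = 0,
      forall a b x y, homogeneous g a x -> homogeneous g b y ->
        form B y x = (-1) ^+ (a && b) * form B x y,
      forall x y z, form B (bracket g x y) z = form B x (bracket g y z) &
      bijective (fun x : 'rV[K]_d => x *m B)].

Definition metric_lie_superalgebra g : Prop :=
  lie_superalgebra g /\ exists B, invariant_metric g B.

End Superalgebra.

Definition isomorphic (K : comNzRingType) (d d' : nat)
    (g : superalgebra K d) (h : superalgebra K d') : Prop :=
  exists f : {linear 'rV[K]_d -> 'rV[K]_d'},
    [/\ bijective f,
        forall a x, homogeneous g a x -> homogeneous h a (f x) &
        forall x y, f (bracket g x y) = bracket h (f x) (f y)].

Definition direct_sum (K : comNzRingType) (d d' : nat)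
    (g : superalgebra K d) (h : superalgebra K d') : superalgebra K (d + d') :=
  SuperAlgebra
    (fun i => match fintype.split i with
              | inl i1 => parity g i1
              | inr i2 => parity h i2
              end)
    (fun i j => match fintype.split i, fintype.split j with
                | inl i1, inl j1 => row_mx (sc g i1 j1) 0
                | inr i2, inr j2 => row_mx 0 (sc h i2 j2)
                | _, _ => 0
                end).

(** ** Deformations *)

Section Deformations.
Context {C : numFieldType} {d : nat}.
Implicit Types (g : superalgebra C d) (phi : nat -> 'I_d -> 'I_d -> 'rV[C]_d).

(* [phi n] lists the structure constants of the n-th bilinear map, with
   [phi 0] those of the undeformed bracket. *)
Definition deformed g phi : superalgebra (fps C) d :=
  SuperAlgebra (parity g) (fun i j => \row_k Fps (fun n => phi n i j 0 k)).

(* Evenness and super-skew-symmetry over C[[t]] mean, coefficientwise, that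
   every [phi n] is even and super-skew-symmetric. *)
Definition formal_deformation g phi : Prop :=
  phi 0%N = sc g /\ lie_superalgebra (deformed g phi).

Definition metric_deformation g phi : Prop :=
  formal_deformation g phi /\ metric_lie_superalgebra (deformed g phi).

(* Giving [t] a value requires the structure constants to converge. *)
Definition term phi (i j k : 'I_d) (t : C) : C^nat :=
  fun n => phi n i j 0 k * t ^+ n.

Definition convergent phi : Prop :=
  \forall t \near (0 : C), forall i j k, cvgn (series (term phi i j k t)).

Definition specialize g phi (t : C) : superalgebra C d :=
  SuperAlgebra (parity g)
    (fun i j => \row_k limn (series (term phi i j k t))).

Definition jump_deformation (d' : nat) g phi (h : superalgebra C d') : Prop :=
  [/\ convergent phi,
      \forall t \near (0 : C)^', isomorphic (specialize g phi t) h &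
      ~ isomorphic g h].

(* A symmetry of a deformation is the germ at 0 of a biholomorphic change of
   parameter that preserves the isomorphism class of the deformed algebra. *)
Definition deformation_symmetry g phi (s : C -> C) : Prop :=
  [/\ s 0 = 0,
      \forall t \near (0 : C), derivable s t 1,
      derive1 s 0 != 0 &
      \forall t \near (0 : C)^',
        isomorphic (specialize g phi (s t)) (specialize g phi t)].

(* Coincidences are allowed only when they come from finitely many symmetries;
   finiteness is what rules out jump deformations, for which every change of
   parameter is a symmetry. *)
Definition smooth_deformation g phi : Prop :=
  convergent phi /\
  exists (N : nat) (s : 'I_N -> C -> C),
    (forall l, deformation_symmetry g phi (s l)) /\
    \forall t \near (0 : C)^' & u \near (0 : C)^',
      isomorphic (specialize g phi t) (specialize g phi u) ->
      t = u \/ exists l, u = s l t.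

Definition smooth_deformation_to_family (d' : nat) g phi
    (h : C -> superalgebra C d') (lam0 : C) : Prop :=
  smooth_deformation g phi /\
  exists lam : C -> C,
    (lam t @[t --> (0 : C)^'] --> lam0) /\
    \forall t \near (0 : C)^', isomorphic (specialize g phi t) (h (lam t)).

Definition has_jump_metric_deformation (d' : nat) g (h : superalgebra C d') :=
  exists phi, metric_deformation g phi /\ jump_deformation g phi h.

Definition has_smooth_metric_deformation (d' : nat) g
    (h : C -> superalgebra C d') (lam0 : C) :=
  exists phi, metric_deformation g phi /\
    smooth_deformation_to_family g phi h lam0.

End Deformations.

(** ** The algebras *)

Section Algebras.
Context {C : comNzRingType}.

Definition parity_of (m d : nat) : 'I_d -> bool := fun i => (m <= i)%N.

Definition e {d : nat} (k : nat) : 'rV[C]_d.+1 := delta_mx 0 (inord k.-1).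

(* Superalgebra of dimension m|(d+1-m) given by a list of entries (p, q, v),
   each meaning [e_p, e_q] = v with indices starting at 1; each unordered pair
   {p, q} is meant to occur at most once, and an entry also fixes
   [e_q, e_p] by super-skew-symmetry. *)
Definition of_table (m d : nat) (s : seq (nat * nat * 'rV[C]_d.+1)) :
    superalgebra C d.+1 :=
  SuperAlgebra (@parity_of m d.+1) (fun i j =>
    \sum_(b <- s)
      if (b.1.1 == i.+1) && (b.1.2 == j.+1) then b.2
      else if (b.1.1 == j.+1) && (b.1.2 == i.+1) then
        - (-1) ^+ (parity_of m i && parity_of m j) *: b.2
      else 0).

Definition abelian (m n : nat) : superalgebra C (m + n) :=
  SuperAlgebra (@parity_of m (m + n)) (fun _ _ => 0).

Definition g22_2 : superalgebra C 4 := @of_table 2 3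
  [:: ((3, 4)%N, e 1); ((2, 3)%N, e 3); ((2, 4)%N, - e 4)].

Definition g24_1 : superalgebra C 6 := @of_table 2 5
  [:: ((2, 4)%N, e 3); ((2, 5)%N, - e 6); ((4, 5)%N, e 1)].

Definition g24_2 : superalgebra C 6 := @of_table 2 5
  [:: ((2, 4)%N, e 4); ((2, 5)%N, e 3); ((2, 6)%N, - e 6);
      ((5, 5)%N, e 1); ((4, 6)%N, e 1)].

Definition g24_3 (lam : C) : superalgebra C 6 := @of_table 2 5
  [:: ((2, 3)%N, e 3); ((2, 4)%N, lam *: e 4); ((2, 5)%N, - e 5);
      ((2, 6)%N, - lam *: e 6); ((3, 5)%N, e 1); ((4, 6)%N, lam *: e 1)].

Definition g24_4 : superalgebra C 6 := @of_table 2 5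
  [:: ((2, 3)%N, e 3); ((2, 4)%N, e 3 + e 4); ((2, 5)%N, - e 5 - e 6);
      ((2, 6)%N, - e 6); ((3, 5)%N, e 1); ((4, 5)%N, e 1); ((4, 6)%N, e 1)].

Definition g24_5 : superalgebra C 6 := @of_table 2 5
  [:: ((2, 3)%N, e 5); ((2, 4)%N, e 3); ((2, 5)%N, - e 6); ((3, 3)%N, - e 1);
      ((4, 5)%N, e 1)].

End Algebras.

(* Main.v *)
Require Import Defs.
From HB Require Import structures.
From mathcomp Require Import all_boot all_order all_algebra.
From mathcomp Require Import complex ring.
From mathcomp Require Import all_classical all_reals all_analysis.
Import Order.TTheory GRing.Theory Num.Theory.
Import numFieldNormedType.Exports Defs.
Local Open Scope classical_set_scope.
Local Open Scope ring_scope.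
Set Implicit Arguments.
Unset Strict Implicit.
Unset Printing Implicit Defensive.

(** Up to the choice of a basis, the algebras concerned are double extensions of
a symplectic space V: e_1 is central, [x, y] = Q(x, y) e_1 and [e_2, x] = x D for
row vectors x, y in V, with Q symmetric and D = Q J, where J is a fixed matrix
with J^T = - J and J^2 = -1.  This is a metric Lie superalgebra for every
symmetric Q over every commutative ring, so each symmetric matrix Q over C[t]
whose value at 0 belongs to g_{2|4}^1 yields a metric deformation.  Two such
algebras (Q, D) and (Q', D') are isomorphic as soon as m Q = P Q' P^T and
D P = c P D' for an invertible P and non-zero m, c; conversely an isomorphism
gives the second equation.  Hence D^2 = 0 separates g_{2|4}^1 from the other
algebras, and the traces of D^2 and D^4 show that the members t and u of the
families used for the smooth deformations are isomorphic only for u = t or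
u = - t. *)

(** * Double extensions and their bracket *)

Section Dext.
Context {K : comNzRingType} {n : nat}.
Implicit Types (Q D : 'M[K]_n) (x y z : 'rV[K]_(2 + n)).

(** The scalar [a%:R] is the index of an even basis vector: it is 0 for e_1, which is thereby
    central, and 1 for e_2, which acts on row vectors by D. *)
Definition dext Q D : superalgebra K (2 + n) :=
  SuperAlgebra (@parity_of 2 (2 + n)) (fun i j =>
    match fintype.split i, fintype.split j with
    | inl a, inl b => 0
    | inl a, inr b => row_mx 0 (a%:R *: row b D)
    | inr a, inl b => - row_mx 0 (b%:R *: row a D)
    | inr a, inr b => row_mx (Q a b *: delta_mx 0 0) 0
    end).

Definition dbracket Q D x y : 'rV[K]_(2 + n) :=
  row_mx (((rsubmx x *m Q *m (rsubmx y)^T) 0 0) *: delta_mx 0 0)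
    (lsubmx x 0 1 *: (rsubmx y *m D) - lsubmx y 0 1 *: (rsubmx x *m D)).

Lemma dext_bracket Q D x y : bracket (dext Q D) x y = dbracket Q D x y.
Proof.
rewrite /bracket big_split_ord /=.
(* The first argument of the bracket runs over e_1, e_2 in [E1] and over the odd basis vectors in
   [E2]. *)
have E1 (a : 'I_2) : \sum_j (x 0 (lshift n a) * y 0 j) *: sc (dext Q D) (lshift n a) j
   = row_mx 0 ((x 0 (lshift n a) * a%:R) *: (rsubmx y *m D)).
  rewrite big_split_ord /= big1 ?add0r; last first.
    by move=> i _; rewrite (unsplitK (inl a)) (unsplitK (inl i)) scaler0.
  rewrite mulmx_sum_row scaler_sumr.
  transitivity (\sum_(j < n) row_mx (0 : 'rV_2)
     ((x 0 (lshift n a) * a%:R) *: (rsubmx y 0 j *: row j D))).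
    apply: eq_bigr => j _; rewrite (unsplitK (inl a)) (unsplitK (inr j)).
    rewrite scale_row_mx scaler0 !mxE; congr row_mx.
    by rewrite !scalerA mulrAC.
  by elim/big_rec2: _ => [|j u v _ ->]; rewrite ?row_mx0 // add_row_mx addr0.
have E2 (a : 'I_n) : \sum_j (x 0 (rshift 2 a) * y 0 j) *: sc (dext Q D) (rshift 2 a) j
   = row_mx ((rsubmx x 0 a * (\sum_j Q a j * rsubmx y 0 j)) *: delta_mx 0 0)
            (- (lsubmx y 0 1 *: (rsubmx x 0 a *: row a D))).
  rewrite big_split_ord /=.
  rewrite !big_ord_recl big_ord0 /= addr0.
  rewrite (unsplitK (inl ord0)) (unsplitK (inl (lift ord0 ord0))) (unsplitK (inr a)).
  have -> : (lift ord0 ord0 : 'I_2) = 1 by apply/val_inj.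
  rewrite /= scale0r row_mx0 oppr0 scaler0 add0r.
  transitivity (row_mx (0 : 'rV_2) (- (lsubmx y 0 1 *: (rsubmx x 0 a *: row a D))) +
    \sum_(j < n) row_mx ((rsubmx x 0 a * (Q a j * rsubmx y 0 j)) *: delta_mx 0 0) 0).
    congr (_ + _).
      rewrite opp_row_mx scale_row_mx oppr0 scaler0 scale1r; congr row_mx.
      by rewrite scalerN scalerA !mxE [X in X *: _]mulrC.
    apply: eq_bigr => j _; rewrite (unsplitK (inr j)) scale_row_mx scaler0.
    by rewrite scalerA !mxE; congr (row_mx (_ *: _) _); rewrite -mulrA [X in _ * X]mulrC.
  rewrite mulr_sumr scaler_suml.
  set u := - _; transitivity (row_mx (0 : 'rV_2) u + row_mx (\sum_(i < n) (rsubmx x 0 a * (Q a i * rsubmx y 0 i)) *: delta_mx 0 0) 0).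
    congr (_ + _).
    by elim/big_rec2: _ => [|j v w _ ->]; rewrite ?row_mx0 // add_row_mx addr0.
  by rewrite add_row_mx add0r addr0.
rewrite (eq_bigr _ (fun i _ => E1 i)) (eq_bigr _ (fun i _ => E2 i)) {E1 E2}.
rewrite !big_ord_recl big_ord0 /= addr0 mulr0 scale0r row_mx0 add0r.
have -> : (lift ord0 ord0 : 'I_2) = 1 by apply/val_inj.
rewrite mulr1 /dbracket [rsubmx x *m D]mulmx_sum_row -mulmxA.
rewrite [(rsubmx x *m (Q *m _)) 0 0]mxE.
transitivity (row_mx (0 : 'rV_2) (x 0 (lshift n 1) *: (rsubmx y *m D)) +
  row_mx ((\sum_j rsubmx x 0 j * (Q *m (rsubmx y)^T) j 0) *: delta_mx 0 0)
   (- (lsubmx y 0 1 *: \sum_i rsubmx x 0 i *: row i D))).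
  congr (_ + _); rewrite scaler_suml scaler_sumr -sumrN.
  elim/big_rec3: _ => [|i u v w _ ->]; first by rewrite row_mx0.
  rewrite add_row_mx; congr row_mx; congr (_ *: _ + _).
  by rewrite [(Q *m _) i 0]mxE; congr (_ * _); apply: eq_bigr => j _; rewrite !mxE.
by rewrite add_row_mx add0r; congr (row_mx _ (_ *: _ - _)); rewrite mxE.
Qed.

End Dext.

(** * Calculus of bilinear forms *)

Section Form.
Context {K : comNzRingType} {n : nat} (B : 'M[K]_n).
Implicit Types u v w : 'rV[K]_n.

Lemma form_trmx u v : form B^T u v = form B v u.
Proof.
rewrite /form; transitivity ((v *m B *m u^T)^T 0 0); last by rewrite mxE.
by rewrite !trmx_mul trmxK mulmxA.
Qed.

Lemma formDl u v w : form B (u + v) w = form B u w + form B v w.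
Proof. by rewrite /form !mulmxDl mxE. Qed.

Lemma formDr u v w : form B u (v + w) = form B u v + form B u w.
Proof. by rewrite /form linearD mulmxDr mxE. Qed.

Lemma formZl a u v : form B (a *: u) v = a * form B u v.
Proof. by rewrite /form -!scalemxAl mxE. Qed.

Lemma formZr a u v : form B u (a *: v) = a * form B u v.
Proof. by rewrite /form linearZ -scalemxAr mxE. Qed.

Lemma formNl u v : form B (- u) v = - form B u v.
Proof. by rewrite -scaleN1r formZl mulN1r. Qed.

Lemma formNr u v : form B u (- v) = - form B u v.
Proof. by rewrite -scaleN1r formZr mulN1r. Qed.

Lemma form0l u : form B 0 u = 0.
Proof. by rewrite /form !mul0mx mxE. Qed.

Lemma form0r u : form B u 0 = 0.
Proof. by rewrite /form trmx0 mulmx0 mxE. Qed.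

Lemma formN u v : form (- B) u v = - form B u v.
Proof. by rewrite /form mulmxN mulNmx mxE. Qed.

Definition formE := (formDl, formDr, formZl, formZr, formNl, formNr, form0l, form0r).
End Form.

(** * Jacobi identity and invariant form of a double extension *)

Section DextMetric.
Context {K : comNzRingType} {n : nat}.
Implicit Types (Q D J : 'M[K]_n) (x y z : 'rV[K]_(2 + n)).

Lemma homogeneous_dext Q D a x :
  homogeneous (dext Q D) a x <-> (if a then lsubmx x = 0 else rsubmx x = 0).
Proof.
case: a; split=> h.
- by apply/rowP => i; rewrite !mxE h //=; case: i => [[|[|]]].
- move=> i; case: (split_ordP i) => j -> //=.
  by move=> _; have := congr1 (fun v : 'rV_2 => v 0 j) h; rewrite !mxE.
- by apply/rowP => i; rewrite !mxE h.
- move=> i; case: (split_ordP i) => j -> /=; first by case: j => [[|[|]]].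
  by move=> _; have := congr1 (fun v : 'rV_n => v 0 j) h; rewrite !mxE.
Qed.

(** The second hypothesis says that D is skew-adjoint for Q, which makes the e_1-component of the
    Jacobi identity cancel. In the component along V only D^2 occurs, because a bracket has no
    e_2-coordinate, and the terms cancel formally. *)
Lemma dext_lie Q D :
  Q^T = Q -> D *m Q = - (Q *m D^T) -> lie_superalgebra (dext Q D).
Proof.
move=> Qs DQ; have qC u v : form Q u v = form Q v u by rewrite -form_trmx Qs.
have qD u v : form Q (u *m D) v = - form Q u (v *m D).
  by rewrite /form -[u *m D *m Q]mulmxA DQ mulmxN mulNmx mxE trmx_mul !mulmxA.
split.
- move=> a b x y /homogeneous_dext hx /homogeneous_dext hy.
  rewrite dext_bracket; apply/homogeneous_dext; rewrite /dbracket row_mxKl row_mxKr.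
  by case: a hx => hx; case: b hy => hy /=;
     rewrite ?hx ?hy ?mul0mx ?trmx0 ?mulmx0 ?mxE ?scaler0 ?scale0r ?subr0.
- move=> a b x y /homogeneous_dext hx /homogeneous_dext hy.
  rewrite !dext_bracket /dbracket -!/(form _ _ _) scaleNr scale_row_mx opp_row_mx.
  by case: a hx => hx; case: b hy => hy /=;
     rewrite ?hx ?hy ?formE ?mul0mx ?mxE ?scaler0 ?scale0r ?subr0 ?oppr0 ?scaler0
       ?expr1 ?expr0 ?oppr0 ?scale1r ?opprB ?opp0r ?add0r ?opprK //;
     rewrite ?subr0 ?scaleN1r ?opprK // qC.
- move=> a b x y z /homogeneous_dext hx /homogeneous_dext hy.
  rewrite !dext_bracket /dbracket -!/(form _ _ _) !row_mxKl !row_mxKr.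
  rewrite ![(_ *: delta_mx 0 0 : 'rV_2) 0 1]mxE.
  have -> : (delta_mx 0 0 : 'rV[K]_2) 0 1 = 0 by rewrite mxE.
  rewrite !mulr0 !scale0r !subr0 !sub0r scale_row_mx add_row_mx.
  (* The sign is absorbed by an even coordinate, since that coordinate vanishes when the vector is
     odd. *)
  have hx' : (-1) ^+ (a && b) * lsubmx x 0 1 = lsubmx x 0 1.
    by case: a hx => [->|_]; rewrite ?mxE ?mulr0 ?mul1r.
  have hy' : (-1) ^+ (a && b) * lsubmx y 0 1 = lsubmx y 0 1.
    by case: b hy {hx'} => [->|_]; rewrite ?andbF ?mxE ?mulr0 ?mul1r.
  (* On values of Q the sign acts as -1: unless both vectors are odd, one of the odd parts is zero
     and so is the value. *)
  have hz : (-1) ^+ (a && b) * form Q (rsubmx x) (rsubmx y *m D)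
     = - form Q (rsubmx x) (rsubmx y *m D).
    case: a b hx hy {hx' hy'} => [] [] /= hx hy; rewrite ?mulN1r ?mul1r //.
    - by rewrite hy mul0mx form0r oppr0.
    - by rewrite hx form0l oppr0.
    - by rewrite hx form0l oppr0.
  congr row_mx.
    rewrite scalerA -scalerDl; congr (_ *: _).
    rewrite !formE !qD [form Q (rsubmx y) (rsubmx x *m D)]qC qD !mulrDr !mulrA hx'.
    rewrite !mulrN !opprK [(-1) ^+ _ * (_ * _)]mulrCA hz; ring.
  rewrite !mulmxDl !mulNmx -!scalemxAl !scalerBr !scalerA.
  rewrite !hy' opprB [in RHS]addrC addrA [lsubmx z 0 1 * lsubmx y 0 1]mulrC subrK.
  by rewrite [lsubmx y 0 1 * _]mulrC [lsubmx z 0 1 * _]mulrC.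
Qed.

Lemma form_block (B1 : 'M[K]_2) (B2 : 'M[K]_n) x y :
  form (block_mx B1 0 0 B2) x y =
  form B1 (lsubmx x) (lsubmx y) + form B2 (rsubmx x) (rsubmx y).
Proof.
rewrite /form -[x in LHS]hsubmxK -[y in LHS]hsubmxK tr_row_mx mul_row_block mul_row_col.
by rewrite !mulmx0 addr0 add0r mxE.
Qed.

Definition hyperbolic_plane : 'M[K]_2 := \matrix_(i, j) (i != j)%:R.

Lemma form_hyperbolic_plane (u v : 'rV[K]_2) :
  form hyperbolic_plane u v = u 0 0 * v 0 1 + u 0 1 * v 0 0.
Proof.
rewrite /form mxE !big_ord_recl big_ord0 !mxE !big_ord_recl !big_ord0 !mxE /=.
have -> : (lift ord0 ord0 : 'I_2) = 1 by apply/val_inj.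
by rewrite !mulr0 !mulr1 !addr0 !add0r addrC.
Qed.

Lemma hyperbolic_plane_square : hyperbolic_plane *m hyperbolic_plane = 1%:M.
Proof.
apply/matrixP => i j; rewrite !mxE !big_ord_recl big_ord0 !mxE /=.
by case: i => [[|[|]]]//= ?; case: j => [[|[|]]]//= ?;
  rewrite !(mulr0, mulr1, mul0r, addr0, add0r).
Qed.

(* [J *m J = -1] makes the odd block of the Gram matrix below the inverse of [J]. *)
Lemma dext_metric Q J :
  Q^T = Q -> J^T = - J -> J *m J = - 1%:M ->
  metric_lie_superalgebra (dext Q (Q *m J)).
Proof.
move=> Qs Ja JJ; split.
  by apply: dext_lie; rewrite // trmx_mul Ja Qs mulNmx mulmxN opprK mulmxA.
exists (block_mx hyperbolic_plane 0 0 (- J)); split.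
- move=> x y /homogeneous_dext hx /homogeneous_dext hy.
  by rewrite form_block hx hy form0l form0r addr0.
- move=> a b x y /homogeneous_dext hx /homogeneous_dext hy.
  rewrite !form_block !form_hyperbolic_plane.
  rewrite !formN -[form J (rsubmx y) _]form_trmx Ja formN opprK.
  case: a b hx hy => [] [] /= -> ->; rewrite ?form0l ?form0r ?mxE; ring.
- move=> x y z.
  rewrite !dext_bracket /dbracket !form_block !form_hyperbolic_plane !row_mxKl !row_mxKr.
  rewrite -!/(form _ _ _) ![(_ *: delta_mx 0 0 : 'rV_2) _ _]mxE.
  rewrite ![(delta_mx 0 0 : 'rV[K]_2) _ _]mxE /= !mulr0 !mulr1 !mul0r add0r !addr0.
  (* This is the invariance B([e_2, u], v) = B(e_2, [u, v]) for odd u and v, where B is [- J] on the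
     odd part and pairs e_2 with e_1 to 1. *)
  have h1 u v : form (- J) (u *m (Q *m J)) v = form Q u v.
    by rewrite formN /form !mulmxA -[u *m Q *m J *m J]mulmxA JJ mulmxN mulmx1 mulNmx mxE opprK.
  have h2 u v : form (- J) u (v *m (Q *m J)) = - form Q u v.
    by rewrite -form_trmx linearN /= Ja formN h1 -[in LHS]form_trmx Qs.
  rewrite !formE !h1 !h2 -[form Q (rsubmx x) (rsubmx y)]form_trmx Qs; ring.
- exists (fun x => x *m block_mx hyperbolic_plane 0 0 J) => x; rewrite -mulmxA mulmx_block.
    rewrite !mulmx0 !mul0mx !addr0 add0r hyperbolic_plane_square mulNmx JJ opprK.
    by rewrite -scalar_mx_block mulmx1.
  rewrite !mulmx0 !mul0mx !addr0 add0r hyperbolic_plane_square mulmxN JJ opprK.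
  by rewrite -scalar_mx_block mulmx1.
Qed.

End DextMetric.

(** * Isomorphisms between double extensions *)

Section Equivalence.
Context {K : fieldType} {n : nat}.
Implicit Types (Q D P : 'M[K]_n).

(** The intended isomorphism sends e_1 to m e_1, e_2 to c e_2 and an odd row vector x to x P; the
    two equations are its compatibility with [x, y] and with [e_2, x]. *)
Definition dext_equiv Q D Q' D' : Prop :=
  exists (m c : K) P, [/\ m != 0, c != 0, P \in unitmx,
    m *: Q = P *m Q' *m P^T & D *m P = c *: (P *m D')].

Lemma dext_equiv_sym Q D Q' D' : dext_equiv Q D Q' D' -> dext_equiv Q' D' Q D.
Proof.
move=> [m [c [P [m0 c0 uP hQ hD]]]].
exists m^-1, c^-1, (invmx P); split; rewrite ?invr_eq0 ?unitmx_inv //.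
  have -> : Q = m^-1 *: (P *m Q' *m P^T) by rewrite -hQ scalerA mulVf ?scale1r.
  rewrite -scalemxAr -scalemxAl !mulmxA mulVmx // mul1mx trmx_inv -mulmxA mulmxV ?mulmx1 //.
  by rewrite unitmx_tr.
have -> : D = c *: (P *m D' *m invmx P) by rewrite scalemxAl -hD mulmxK.
by rewrite -scalemxAr scalerA mulVf // scale1r !mulmxA mulVmx // mul1mx.
Qed.

Lemma dext_equiv_trans Q1 D1 Q2 D2 Q3 D3 :
  dext_equiv Q1 D1 Q2 D2 -> dext_equiv Q2 D2 Q3 D3 -> dext_equiv Q1 D1 Q3 D3.
Proof.
move=> [m [c [P [m0 c0 uP hQ hD]]]] [m' [c' [P' [m0' c0' uP' hQ' hD']]]].
exists (m' * m), (c * c'), (P *m P'); split; rewrite ?mulf_neq0 ?unitmx_mul ?uP //.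
  by rewrite -scalerA hQ trmx_mul scalemxAl scalemxAr hQ' !mulmxA.
by rewrite mulmxA hD -scalemxAl -mulmxA hD' -scalemxAr scalerA !mulmxA.
Qed.

Lemma dext_equiv_isomorphic Q D Q' D' :
  dext_equiv Q D Q' D' -> isomorphic (dext Q D) (dext Q' D').
Proof.
move=> [m [c [P [m0 c0 uP hQ hD]]]].
pose d : 'M[K]_2 := diag_mx (\row_i (if i == 0 then m else c)).
pose M : 'M[K]_(2 + n) := block_mx d 0 0 P.
have lM x : lsubmx (x *m M) = lsubmx x *m d.
  by rewrite -{1}[x]hsubmxK mul_row_block row_mxKl mulmx0 addr0.
have rM x : rsubmx (x *m M) = rsubmx x *m P.
  by rewrite -{1}[x]hsubmxK mul_row_block row_mxKr mulmx0 add0r.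
have ud : d \in unitmx.
  rewrite unitmxE det_diag !big_ord_recl big_ord0 !mxE /= mulr1 unitfE.
  by rewrite mulf_neq0.
exists (mulmxr M); split.
- exists (mulmxr (block_mx (invmx d) 0 0 (invmx P))) => x /=;
    rewrite -mulmxA mulmx_block !mulmx0 !mul0mx !addr0 add0r ?mulmxV ?mulVmx //;
    by rewrite -scalar_mx_block mulmx1.
- move=> a x /homogeneous_dext hx; apply/homogeneous_dext; rewrite /= lM rM.
  by case: a hx => ->; rewrite mul0mx.
- move=> x y; rewrite !dext_bracket /= /dbracket !lM !rM mul_row_block !mulmx0 addr0 add0r.
  have dE (u : 'rV[K]_2) : (u *m d) 0 1 = u 0 1 * c.
    rewrite mxE !big_ord_recl big_ord0 !mxE /=.
    have -> : (lift ord0 ord0 : 'I_2) = 1 by apply/val_inj.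
    by rewrite mulr0n mulr1n mulr0 add0r addr0.
  congr row_mx.
    rewrite trmx_mul -!mulmxA [P *m _]mulmxA [P *m Q' *m _]mulmxA -hQ.
    rewrite -[m *: Q *m _]scalemxAl -scalemxAr [in RHS]mxE mulrC -scalerA -scalemxAl; congr (_ *: _).
    apply/rowP => i; rewrite !mxE !big_ord_recl big_ord0 !mxE /=.
    by case: i => [[|[|]]]//= ?; rewrite ?mulr0n ?mulr1n !(mul0r, mul1r, addr0, mulr1, mulr0).
  by rewrite !dE mulmxBl -!scalemxAl -!mulmxA hD -!scalemxAr !scalerA.
Qed.

(** An isomorphism f preserves parity, so it restricts to a matrix P on the odd part, while c is the
    e_2-coordinate of f(e_2). The e_1-coordinate of f(e_2) is central, so applying f to [e_2, x]
    yields the equation. Whether c vanishes is left open; the uses below treat c = 0 separately. *)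
Lemma isomorphic_dext Q D Q' D' : isomorphic (dext Q D) (dext Q' D') ->
  exists (c : K) P, P \in unitmx /\ D *m P = c *: (P *m D').
Proof.
move=> [f [f_bij f_hom f_br]].
pose P := drsubmx (lin1_mx f).
have fo (y : 'rV[K]_n) : f (row_mx 0 y) = row_mx 0 (y *m P).
  have E : f (row_mx 0 y) = row_mx (y *m dlsubmx (lin1_mx f)) (y *m P).
    by rewrite -mul_rV_lin1 -{1}[lin1_mx f]submxK mul_row_block !mul0mx !add0r.
  have /f_hom/homogeneous_dext : homogeneous (dext Q D) true (row_mx 0 y).
    by apply/homogeneous_dext; rewrite row_mxKl.
  by rewrite E row_mxKl => ->.
exists (lsubmx (f (row_mx (delta_mx 0 1) 0)) 0 1), P; split.
  rewrite -row_free_unit; apply/inj_row_free => y yP.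
  have /(bij_inj f_bij) : f (row_mx 0 y) = f 0 by rewrite fo yP row_mx0 linear0.
  by move/(congr1 rsubmx); rewrite row_mxKr linear0.
apply/row_matrixP => i; rewrite !rowE.
set u : 'rV_n := delta_mx 0 i.
have := f_br (row_mx (delta_mx 0 1) 0) (row_mx 0 u).
rewrite !dext_bracket /dbracket fo !row_mxKl !row_mxKr !mul0mx !scaler0 !subr0 mxE scale0r.
rewrite [(delta_mx _ _ : 'rV_2) 0 1]mxE /= scale1r fo => /(congr1 rsubmx).
rewrite !row_mxKr mulmxA => ->.
by rewrite [(0 : 'rV_2) 0 1]mxE scale0r subr0 -scalemxAr !mulmxA.
Qed.

End Equivalence.

(** * Polynomial families of superalgebras as formal deformations *)

Definition map_superalgebra (K L : comNzRingType) d (f : K -> L)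
    (g : superalgebra K d) : superalgebra L d :=
  SuperAlgebra (parity g) (fun i j => map_mx f (sc g i j)).

(** Applied to the two base changes from C[t]: the inclusion into C[[t]] gives the formal
    deformation, the evaluation at t its specialisation. *)
Lemma map_dext (K L : comNzRingType) n (f : {rmorphism K -> L}) (Q D : 'M[K]_n) :
  map_superalgebra f (dext Q D) = dext (map_mx f Q) (map_mx f D).
Proof.
congr SuperAlgebra; apply/funext => i; apply/funext => j /=.
case: fintype.split => a; case: fintype.split => b; rewrite ?map_mx0 //.
- by rewrite map_row_mx map_mx0 map_mxZ rmorph_nat map_row.
- by rewrite map_mxN map_row_mx map_mx0 map_mxZ rmorph_nat map_row.
- by rewrite map_row_mx map_mx0 map_mxZ map_delta_mx mxE.
Qed.

Definition fps_of_poly (K : comNzRingType) (p : {poly K}) : fps K := Fps (fun n => p`_n).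

Fact fps_of_poly_is_zmod_morphism (K : comNzRingType) : zmod_morphism (@fps_of_poly K).
Proof. by move=> p q; apply/fpsP => n; apply: coefB. Qed.

Fact fps_of_poly_is_monoid_morphism (K : comNzRingType) :
  monoid_morphism (@fps_of_poly K).
Proof.
split; first by apply/fpsP => n; apply: coef1.
by move=> p q; apply/fpsP => n; apply: coefM.
Qed.

HB.instance Definition _ (K : comNzRingType) := GRing.isZmodMorphism.Build
  {poly K} (fps K) (@fps_of_poly K) (@fps_of_poly_is_zmod_morphism K).
HB.instance Definition _ (K : comNzRingType) := GRing.isMonoidMorphism.Build
  {poly K} (fps K) (@fps_of_poly K) (@fps_of_poly_is_monoid_morphism K).

Section PolyDeformation.
Context {C : numFieldType} {d : nat}.
Implicit Types (G : superalgebra {poly C} d) (g : superalgebra C d).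

Definition poly_deformation G : nat -> 'I_d -> 'I_d -> 'rV[C]_d :=
  fun n i j => map_mx (coefp n) (sc G i j).

Definition eval_superalgebra (t : C) G := map_superalgebra (horner_eval t) G.

Lemma deformed_poly g G : parity g = parity G ->
  deformed g (poly_deformation G) = map_superalgebra (@fps_of_poly C) G.
Proof.
move=> gG; rewrite /deformed gG; congr SuperAlgebra.
apply/funext => i; apply/funext => j; apply/rowP => k; rewrite !mxE.
by apply/fpsP => n /=; rewrite mxE.
Qed.

(** The partial sums are constant from index [size p] on. *)
Lemma poly_series_cvg (p : {poly C}) (t : C) :
  series (fun n => p`_n * t ^+ n) n @[n --> \oo] --> p.[t].
Proof.
have H : \forall n \near \oo, series (fun n => p`_n * t ^+ n) n = p.[t].
  by exists (size p) => // n /= pn; rewrite /series /= (horner_coef_wide _ pn) big_mkord.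
exact: (@cvg_near_cst nat C _ _ _ _ H).
Qed.

Lemma convergent_poly G : convergent (poly_deformation G).
Proof.
rewrite /convergent; near=> t => i j k; apply/cvg_ex; exists ((sc G i j 0 k).[t]).
have -> : term (poly_deformation G) i j k t = fun n => (sc G i j 0 k)`_n * t ^+ n.
  by apply/funext => n; rewrite /term mxE.
exact: poly_series_cvg.
Unshelve. all: by end_near.
Qed.

Lemma specialize_poly g G t : parity g = parity G ->
  specialize g (poly_deformation G) t = eval_superalgebra t G.
Proof.
move=> gG; rewrite /specialize gG; congr SuperAlgebra.
apply/funext => i; apply/funext => j; apply/rowP => k; rewrite !mxE.
have -> : term (poly_deformation G) i j k t = fun n => (sc G i j 0 k)`_n * t ^+ n.
  by apply/funext => n; rewrite /term mxE.
exact/cvg_lim/poly_series_cvg.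
Qed.

End PolyDeformation.

(** The conditions on Q and J survive the passage to C[[t]], where [dext_metric] applies; the
    constant coefficients are the values at 0. *)
Lemma metric_deformation_dext (C : numFieldType) n (Q : 'M[{poly C}]_n) (J : 'M[C]_n) :
  Q^T = Q -> J^T = - J -> J *m J = - 1%:M ->
  let G := dext Q (Q *m map_mx polyC J) in
  metric_deformation (eval_superalgebra 0 G) (poly_deformation G).
Proof.
move=> Qs Ja JJ G; have H : metric_lie_superalgebra (deformed (eval_superalgebra 0 G) (poly_deformation G)).
  rewrite deformed_poly // map_dext map_mxM; apply: dext_metric.
  - by rewrite matrix.map_trmx Qs.
  - by rewrite !matrix.map_trmx Ja !map_mxN.
  - by rewrite -!map_mxM JJ !map_mxN !map_mx1.
split=> //; split; last by case: H.
apply/funext => i; apply/funext => j; apply/rowP => k; rewrite !mxE.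
by rewrite /horner_eval horner_coef0.
Qed.

(** * The algebras of the theorem as double extensions *)

Definition mx_entry (K : comNzRingType) (s : seq (seq K)) (i j : nat) : K :=
  nth 0 (nth [::] s i) j.

(** Matrices are given by lists so that concrete entries simplify by computation and a matrix
    identity splits into scalar identities. *)
Definition mx_of_rows (K : comNzRingType) m n (s : seq (seq K)) : 'M[K]_(m, n) :=
  \matrix_(i, j) mx_entry s i j.

Section Tables.
Context {K : comNzRingType}.
Implicit Types (q d : seq (seq K)).

Lemma row_mx0e (v : 'rV[K]_4) : row_mx (0 : 'rV[K]_2) v =
  v 0 (inord 0) *: e 3 + v 0 (inord 1) *: e 4 + v 0 (inord 2) *: e 5 + v 0 (inord 3) *: e 6
  :> 'rV_6.
Proof.
apply/rowP => k; case: (@split_ordP 2 4 k) => j ->.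
  rewrite (@row_mxEl _ 1 2 4) !mxE -!val_eqE /= !inordK //.
  by case: j => [[|[|]]]//= ?; rewrite !mulr0 !addr0.
rewrite (@row_mxEr _ 1 2 4) !mxE -!val_eqE /= !inordK //.
case: j => [[|[|[|[|]]]]]//= ?; rewrite ?mulr0 ?mulr1 ?add0r ?addr0;
  congr (v 0 _); apply/val_inj; by rewrite /= inordK.
Qed.

Lemma row_mxe0 : row_mx (delta_mx 0 0 : 'rV[K]_2) (0 : 'rV[K]_4) = e 1 :> 'rV_6.
Proof.
apply/rowP => k; case: (@split_ordP 2 4 k) => j ->; rewrite ?(@row_mxEl _ 1 2 4) ?(@row_mxEr _ 1 2 4) !mxE -!val_eqE /= inordK //.
Qed.

Definition row_table d (b : nat) : 'rV[K]_6 :=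
  mx_entry d b 0 *: e 3 + mx_entry d b 1 *: e 4 + mx_entry d b 2 *: e 5 + mx_entry d b 3 *: e 6.

(** Expressed in the vectors e_k, the structure constants can be compared with those of a table;
    subtracting 2 turns the index of an odd basis vector into a row or column index. *)
Lemma sc_dext_rows q d (i j : 'I_6) :
  sc (dext (mx_of_rows 4 4 q) (mx_of_rows 4 4 d)) i j =
  if (i < 2)%N then if (j < 2)%N then 0 else i%:R *: row_table d (j - 2)
  else if (j < 2)%N then - (j%:R *: row_table d (i - 2))
  else mx_entry q (i - 2) (j - 2) *: e 1.
Proof.
have rowE b : row_mx (0 : 'rV[K]_2) (row b (mx_of_rows 4 4 d)) = row_table d b.
  by rewrite row_mx0e /row_table !mxE !inordK.
have rowZ (a : K) b : row_mx (0 : 'rV[K]_2) (a *: row b (mx_of_rows 4 4 d)) = a *: row_table d b.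
  by rewrite -rowE (@scale_row_mx _ 1 2 4) scaler0.
rewrite /=; case: (@split_ordP 2 4 i) => a ->; case: (@split_ordP 2 4 j) => b bj; rewrite ?bj /=;
  rewrite ?ltn_ord //.
- by rewrite rowZ addKn.
- by rewrite rowZ addKn.
- by rewrite !addKn -row_mxe0 (@scale_row_mx _ 1 2 4) scaler0 mxE.
Qed.

Lemma dext_of_table q d (g : superalgebra K 6) :
  parity g = @parity_of 2 6 ->
  (forall i j, sc g i j = sc (dext (mx_of_rows 4 4 q) (mx_of_rows 4 4 d)) i j) ->
  g = dext (mx_of_rows 4 4 q) (mx_of_rows 4 4 d).
Proof.
case: g => p s /= -> H; congr SuperAlgebra.
by apply/funext => i; apply/funext => j; exact: H.
Qed.

Ltac table_tac :=
  apply: dext_of_table => //; let i := fresh "i" in let j := fresh "j" in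
  move=> i j; rewrite sc_dext_rows /= !big_cons big_nil /=;
  rewrite /row_table /mx_entry;
  case: i => [[|[|[|[|[|[|]]]]]] ? //]; case: j => [[|[|[|[|[|[|]]]]]] ? //] /=;
  rewrite /parity_of /= ?subn2 /= ?expr1 ?expr0 ?scaleN1r ?opprK ?scale1r ?scale0r ?scaleNr
   ?(scale1r, scale0r, scaleNr, oppr0, addr0, add0r, scaler0, opprK, scalerN, opprD) //.

Lemma g24_1E : g24_1 (C:=K) = dext
  (mx_of_rows 4 4 [:: [:: 0; 0; 0; 0]; [:: 0; 0; 1; 0]; [:: 0; 1; 0; 0]; [:: 0; 0; 0; 0]])
  (mx_of_rows 4 4 [:: [:: 0; 0; 0; 0]; [:: 1; 0; 0; 0]; [:: 0; 0; 0; -1]; [:: 0; 0; 0; 0]]).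
Proof. table_tac. Qed.

Lemma g24_2E : g24_2 (C:=K) = dext
  (mx_of_rows 4 4 [:: [:: 0; 0; 0; 0]; [:: 0; 0; 0; 1]; [:: 0; 0; 1; 0]; [:: 0; 1; 0; 0]])
  (mx_of_rows 4 4 [:: [:: 0; 0; 0; 0]; [:: 0; 1; 0; 0]; [:: 1; 0; 0; 0]; [:: 0; 0; 0; -1]]).
Proof. table_tac. Qed.

Lemma g24_3E (l : K) : g24_3 l = dext
  (mx_of_rows 4 4 [:: [:: 0; 0; 1; 0]; [:: 0; 0; 0; l]; [:: 1; 0; 0; 0]; [:: 0; l; 0; 0]])
  (mx_of_rows 4 4 [:: [:: 1; 0; 0; 0]; [:: 0; l; 0; 0]; [:: 0; 0; -1; 0]; [:: 0; 0; 0; -l]]).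
Proof. table_tac. Qed.

Lemma g24_4E : g24_4 (C:=K) = dext
  (mx_of_rows 4 4 [:: [:: 0; 0; 1; 0]; [:: 0; 0; 1; 1]; [:: 1; 1; 0; 0]; [:: 0; 1; 0; 0]])
  (mx_of_rows 4 4 [:: [:: 1; 0; 0; 0]; [:: 1; 1; 0; 0]; [:: 0; 0; -1; -1]; [:: 0; 0; 0; -1]]).
Proof. table_tac. Qed.

Lemma g24_5E : g24_5 (C:=K) = dext
  (mx_of_rows 4 4 [:: [:: -1; 0; 0; 0]; [:: 0; 0; 1; 0]; [:: 0; 1; 0; 0]; [:: 0; 0; 0; 0]])
  (mx_of_rows 4 4 [:: [:: 0; 0; 1; 0]; [:: 1; 0; 0; 0]; [:: 0; 0; 0; -1]; [:: 0; 0; 0; 0]]).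
Proof. table_tac. Qed.

Lemma row_mx_e (k : nat) : (0 < k <= 4)%N -> row_mx (e k : 'rV[K]_4) (0 : 'rV[K]_2) = e k :> 'rV_6.
Proof.
move=> /andP[k0 k4]; have k4' : (k.-1 < 4)%N by case: k k0 k4.
apply/rowP => l; case: (@split_ordP 4 2 l) => a ->;
  rewrite ?(@row_mxEl _ 1 4 2) ?(@row_mxEr _ 1 4 2) !mxE -!val_eqE /= !inordK //;
  try exact: leq_trans k4' _.
by rewrite -(inordK k4') gtn_eqF // ltn_addr.
Qed.

(** The abelian summand supplies the last two basis vectors, both odd, so the even vectors stay in
    front and the splitting 4 + 2 can be compared with 2 + 4. *)
Lemma direct_sum_g22_2E : direct_sum (g22_2 (C:=K)) (abelian 0 2) = dext
  (mx_of_rows 4 4 [:: [:: 0; 1; 0; 0]; [:: 1; 0; 0; 0]; [:: 0; 0; 0; 0]; [:: 0; 0; 0; 0]])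
  (mx_of_rows 4 4 [:: [:: 1; 0; 0; 0]; [:: 0; -1; 0; 0]; [:: 0; 0; 0; 0]; [:: 0; 0; 0; 0]]).
Proof.
apply: dext_of_table.
  by apply/funext => i /=; case: (@split_ordP 4 2 i) => a ->.
move=> i j; rewrite sc_dext_rows /=.
case: (@split_ordP 4 2 i) => a ai; rewrite ?ai /=;
  case: (@split_ordP 4 2 j) => b bj; rewrite ?bj /= {i j ai bj} /row_table /mx_entry.
- rewrite !big_cons big_nil /=.
  case: a => [[|[|[|[|]]]] ? //]; case: b => [[|[|[|[|]]]] ? //] /=;
  rewrite /parity_of /= ?subn2 /= ?expr1 ?expr0;
  rewrite ?(scaleN1r, scale1r, scale0r, scaleNr, oppr0, addr0, add0r, scaler0, opprK, scalerN, opprD, row_mx_e, row_mx0) //;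
  by rewrite -[X in row_mx _ X]oppr0 -(@opp_row_mx _ 1 4 2) row_mx_e.
- case: a => [[|[|[|[|]]]] ? //]; case: b => [[|[|]] ? //] /=;
  rewrite ?(scaleN1r, scale1r, scale0r, scaleNr, oppr0, addr0, add0r, scaler0, opprK, scalerN, opprD, row_mx_e, row_mx0) //.
- case: b => [[|[|[|[|]]]] ? //]; case: a => [[|[|]] ? //] /=;
  rewrite ?(scaleN1r, scale1r, scale0r, scaleNr, oppr0, addr0, add0r, scaler0, opprK, scalerN, opprD, row_mx_e, row_mx0) //.
- case: b => [[|[|]] ? //]; case: a => [[|[|]] ? //] /=;
  rewrite ?(scaleN1r, scale1r, scale0r, scaleNr, oppr0, addr0, add0r, scaler0, opprK, scalerN, opprD, row_mx_e, row_mx0) //.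
Qed.

End Tables.

(** * Matrix arithmetic on lists of rows *)

Definition mul_rows (K : comNzRingType) (s s' : seq (seq K)) : seq (seq K) :=
  mkseq (fun i => mkseq (fun j =>
    mx_entry s i 0 * mx_entry s' 0 j + mx_entry s i 1 * mx_entry s' 1 j +
    mx_entry s i 2 * mx_entry s' 2 j + mx_entry s i 3 * mx_entry s' 3 j) 4) 4.

Definition tr_rows (K : comNzRingType) (s : seq (seq K)) : seq (seq K) :=
  mkseq (fun i => mkseq (fun j => mx_entry s j i) 4) 4.

Definition scale_rows (K : comNzRingType) (a : K) (s : seq (seq K)) : seq (seq K) :=
  mkseq (fun i => mkseq (fun j => a * mx_entry s i j) 4) 4.

Definition unit_rows (K : comNzRingType) : seq (seq K) :=
  mkseq (fun i => mkseq (fun j => (i == j)%:R) 4) 4.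

(** The form [- J] pairs e_3 with e_5 and e_4 with e_6; for this J the algebra [g24_1] has D = Q J
    in its given basis. *)
Definition symplectic_rows (K : comNzRingType) : seq (seq K) :=
  [:: [:: 0; 0; -1; 0]; [:: 0; 0; 0; -1]; [:: 1; 0; 0; 0]; [:: 0; 1; 0; 0]].

Definition mul_symplectic_rows (K : comNzRingType) (s : seq (seq K)) : seq (seq K) :=
  mkseq (fun i => [:: mx_entry s i 2; mx_entry s i 3; - mx_entry s i 0; - mx_entry s i 1]) 4.

Section Rows.
Context {K : comNzRingType}.
Implicit Types s : seq (seq K).
Local Notation mx4 := (mx_of_rows 4 4).

Lemma eq_mx_of_rows s s' :
  (forall i j, (i < 4)%N -> (j < 4)%N -> mx_entry s i j = mx_entry s' i j) ->
  mx4 s = mx4 s'.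
Proof. by move=> H; apply/matrixP => i j; rewrite !mxE H. Qed.

Lemma mx_entry_mkseq (F : nat -> nat -> K) m n i j : (i < m)%N -> (j < n)%N ->
  mx_entry (mkseq (fun i => mkseq (F i) n) m) i j = F i j.
Proof. by move=> im jn; rewrite /mx_entry !nth_mkseq. Qed.

Lemma mul_mx_of_rows s s' : mx4 s *m mx4 s' = mx4 (mul_rows s s').
Proof.
apply/matrixP => i j; rewrite !mxE mx_entry_mkseq //.
by rewrite !big_ord_recl big_ord0 !mxE addr0 !addrA.
Qed.

Lemma tr_mx_of_rows s : (mx4 s)^T = mx4 (tr_rows s).
Proof. by apply/matrixP => i j; rewrite !mxE mx_entry_mkseq. Qed.

Lemma scale_mx_of_rows a s : a *: mx4 s = mx4 (scale_rows a s).
Proof. by apply/matrixP => i j; rewrite !mxE mx_entry_mkseq. Qed.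

Lemma unit_mx_of_rows : mx4 (unit_rows K) = 1%:M.
Proof. by apply/matrixP => i j; rewrite !mxE mx_entry_mkseq. Qed.

Lemma mul_mx_symplectic s : mx4 s *m mx4 (symplectic_rows K) = mx4 (mul_symplectic_rows s).
Proof.
rewrite mul_mx_of_rows; apply: eq_mx_of_rows => i j i4 j4.
rewrite mx_entry_mkseq // /mx_entry nth_mkseq //.
by case: j j4 => [|[|[|[|]]]] //= _; rewrite !(mulr0, mulr1, mulrN, addr0, add0r).
Qed.

End Rows.

Ltac mx_tac :=
  let i := fresh "i" in let j := fresh "j" in
  apply: eq_mx_of_rows => i j;
  case: i => [|[|[|[|i]]]] //; case: j => [|[|[|[|j]]]] // _ _;
  rewrite /scale_rows /mul_rows /tr_rows /unit_rows /mul_symplectic_rows /mx_entry /=.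

Lemma symplectic_trmx (K : comNzRingType) :
  (mx_of_rows 4 4 (symplectic_rows K))^T = - mx_of_rows 4 4 (symplectic_rows K).
Proof.
rewrite -scaleN1r tr_mx_of_rows scale_mx_of_rows; mx_tac; ring.
Qed.

Lemma symplectic_square (K : comNzRingType) :
  mx_of_rows 4 4 (symplectic_rows K) *m mx_of_rows 4 4 (symplectic_rows K) = - 1%:M.
Proof.
rewrite -scaleN1r -unit_mx_of_rows scale_mx_of_rows mul_mx_of_rows; mx_tac; ring.
Qed.

(** The list [p'] is an explicit right inverse of [p], so that invertibility is also checked entry
    by entry. *)
Lemma rows_equiv (K : fieldType) (m c : K) (p p' q d q' d' : seq (seq K)) :
  m != 0 -> c != 0 ->
  mx_of_rows 4 4 (mul_rows p p') = mx_of_rows 4 4 (unit_rows K) ->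
  mx_of_rows 4 4 (scale_rows m q) = mx_of_rows 4 4 (mul_rows (mul_rows p q') (tr_rows p)) ->
  mx_of_rows 4 4 (mul_rows d p) = mx_of_rows 4 4 (scale_rows c (mul_rows p d')) ->
  dext_equiv (mx_of_rows 4 4 q) (mx_of_rows 4 4 d) (mx_of_rows 4 4 q') (mx_of_rows 4 4 d').
Proof.
move=> m0 c0 pp hq hd; exists m, c, (mx_of_rows 4 4 p); split=> //.
- by move: pp; rewrite -mul_mx_of_rows unit_mx_of_rows => /mulmx1_unit[].
- by rewrite scale_mx_of_rows tr_mx_of_rows !mul_mx_of_rows.
- by rewrite !mul_mx_of_rows scale_mx_of_rows.
Qed.

(** * Explicit changes of basis *)

Section Equivalences.
Context {C : numFieldType}.
Implicit Types a b t l : C.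

Definition diag_q l : seq (seq C) :=
  [:: [:: 0; 0; 1; 0]; [:: 0; 0; 0; l]; [:: 1; 0; 0; 0]; [:: 0; l; 0; 0]].
Definition diag_d l : seq (seq C) :=
  [:: [:: 1; 0; 0; 0]; [:: 0; l; 0; 0]; [:: 0; 0; -1; 0]; [:: 0; 0; 0; -l]].
(** Here D acts on the span of e_3, e_4 by the lower triangular matrix with diagonal a, b and entry
    1 below it, and on the span of e_5, e_6 by minus the transpose. At a = b = 0 this is [g24_1]. *)
Definition lower_q a b : seq (seq C) :=
  [:: [:: 0; 0; a; 0]; [:: 0; 0; 1; b]; [:: a; 1; 0; 0]; [:: 0; b; 0; 0]].

Definition rows_dext_equiv (q : seq (seq C)) q' d' :=
  dext_equiv (mx_of_rows 4 4 q) (mx_of_rows 4 4 (mul_symplectic_rows q))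
    (mx_of_rows 4 4 q') (mx_of_rows 4 4 d').

(** Since a differs from b, D is diagonalisable: the rows of [p'] are eigenvectors for a, b, -a, -b,
    and c = a scales the first eigenvalue to 1. *)
Lemma lower_diag_equiv a b : a != 0 -> a != b ->
  rows_dext_equiv (lower_q a b) (diag_q (b / a)) (diag_d (b / a)).
Proof.
move=> a0; rewrite -subr_eq0 => ab0.
pose p := [:: [:: a - b; 0; 0; 0]; [:: 1; 1; 0; 0]; [:: 0; 0; 1; -1]; [:: 0; 0; 0; a - b]].
pose p' := [:: [:: (a - b)^-1; 0; 0; 0]; [:: - (a - b)^-1; 1; 0; 0];
  [:: 0; 0; 1; (a - b)^-1]; [:: 0; 0; 0; (a - b)^-1]].
apply: (@rows_equiv _ ((a - b) / a) a p p').
- by rewrite mulf_neq0 ?invr_eq0.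
- by [].
- by mx_tac; field.
- by mx_tac; field.
- by mx_tac; field.
Qed.

(** For a = b = t there remain Jordan blocks, whose eigenvalues t and -t are brought to 1 and -1 by
    rescaling. *)
Lemma lower_g24_4_equiv t : t != 0 ->
  rows_dext_equiv (lower_q t t)
    [:: [:: 0; 0; 1; 0]; [:: 0; 0; 1; 1]; [:: 1; 1; 0; 0]; [:: 0; 1; 0; 0]]
    [:: [:: 1; 0; 0; 0]; [:: 1; 1; 0; 0]; [:: 0; 0; -1; -1]; [:: 0; 0; 0; -1]].
Proof.
move=> t0.
pose p := [:: [:: t; 0; 0; 0]; [:: 0; 1; 0; 0]; [:: 0; 0; 1; 0]; [:: 0; 0; 0; t]].
pose p' := [:: [:: t^-1; 0; 0; 0]; [:: 0; 1; 0; 0]; [:: 0; 0; 1; 0]; [:: 0; 0; 0; t^-1]].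
by apply: (@rows_equiv _ 1 t p p'); rewrite ?oner_neq0 //; mx_tac; field.
Qed.

(** Exchange the pairs (e_3, e_5) and (e_4, e_6) and rescale e_2 by l. *)
Lemma diag_inv_equiv l : l != 0 ->
  dext_equiv (mx_of_rows 4 4 (diag_q l)) (mx_of_rows 4 4 (diag_d l))
    (mx_of_rows 4 4 (diag_q l^-1)) (mx_of_rows 4 4 (diag_d l^-1)).
Proof.
move=> l0.
pose p : seq (seq C) := [:: [:: 0; 1; 0; 0]; [:: 1; 0; 0; 0]; [:: 0; 0; 0; 1]; [:: 0; 0; 1; 0]].
by apply: (@rows_equiv _ l^-1 l p p); rewrite ?invr_neq0 //; mx_tac; field.
Qed.

(** Send e_4 to e_6 and e_6 to - e_4. *)
Lemma diag_opp_equiv l :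
  dext_equiv (mx_of_rows 4 4 (diag_q (- l))) (mx_of_rows 4 4 (diag_d (- l)))
    (mx_of_rows 4 4 (diag_q l)) (mx_of_rows 4 4 (diag_d l)).
Proof.
pose p : seq (seq C) := [:: [:: 1; 0; 0; 0]; [:: 0; 0; 0; 1]; [:: 0; 0; 1; 0]; [:: 0; -1; 0; 0]].
by apply: (@rows_equiv _ 1 1 p (tr_rows p)); rewrite ?oner_neq0 //; mx_tac; ring.
Qed.

Lemma diag0_sum_equiv :
  dext_equiv (mx_of_rows 4 4 (diag_q 0)) (mx_of_rows 4 4 (diag_d 0))
  (mx_of_rows 4 4 [:: [:: 0; 1; 0; 0]; [:: 1; 0; 0; 0]; [:: 0; 0; 0; 0]; [:: 0; 0; 0; 0]])
  (mx_of_rows 4 4 [:: [:: 1; 0; 0; 0]; [:: 0; -1; 0; 0]; [:: 0; 0; 0; 0]; [:: 0; 0; 0; 0]]).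
Proof.
pose p : seq (seq C) := [:: [:: 1; 0; 0; 0]; [:: 0; 0; 1; 0]; [:: 0; 1; 0; 0]; [:: 0; 0; 0; 1]].
by apply: (@rows_equiv _ 1 1 p p); rewrite ?oner_neq0 //; mx_tac; ring.
Qed.

(** On the span of e_3 and e_4, D has the eigenvalues t and -t, which gives the parameter -1,
    equivalent to 1 by a change of sign. Taking a = b in [lower_q] would produce a Jordan block
    instead. *)
Lemma swap_diag_equiv t : t != 0 ->
  rows_dext_equiv [:: [:: 0; 0; 0; t ^+ 2]; [:: 0; 0; 1; 0]; [:: 0; 1; 0; 0]; [:: t ^+ 2; 0; 0; 0]]
    (diag_q 1) (diag_d 1).
Proof.
move=> t0; apply: dext_equiv_trans (diag_opp_equiv 1).
pose p := [:: [:: t; - t; 0; 0]; [:: 1; 1; 0; 0]; [:: 0; 0; 1; -1]; [:: 0; 0; t; t]].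
pose p' := [:: [:: (2 * t)^-1; 2^-1; 0; 0]; [:: - (2 * t)^-1; 2^-1; 0; 0];
  [:: 0; 0; 2^-1; (2 * t)^-1]; [:: 0; 0; - 2^-1; (2 * t)^-1]].
have n2 : (2 : C) != 0 by rewrite pnatr_eq0.
by apply: (@rows_equiv _ 2 t p p') => //; mx_tac; field; rewrite ?n2 ?t0.
Qed.

(** D sends e_4 + e_5 to e_3 - e_6 and e_3 - e_6 to 0, and has the eigenvalues 2 t and -2 t on the
    span of e_3 + e_6 and e_4 - e_5; hence c = 2 t. The rows of [p'] are these vectors and
    eigenvectors, suitably scaled. *)
Lemma g24_2_equiv t : t != 0 ->
  rows_dext_equiv
    [:: [:: 2 * t ^+ 2; 0; 0; 2 * t ^+ 2]; [:: 0; 0; 1; 0]; [:: 0; 1; 0; 0];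
        [:: 2 * t ^+ 2; 0; 0; 2 * t ^+ 2]]
    [:: [:: 0; 0; 0; 0]; [:: 0; 0; 0; 1]; [:: 0; 0; 1; 0]; [:: 0; 1; 0; 0]]
    [:: [:: 0; 0; 0; 0]; [:: 0; 1; 0; 0]; [:: 1; 0; 0; 0]; [:: 0; 0; 0; -1]].
Proof.
move=> t0; have n2 : (2 : C) != 0 by rewrite pnatr_eq0.
have n4 : (4 : C) != 0 by rewrite pnatr_eq0.
pose p := [:: [:: t; t; 0; t / 2]; [:: 0; 2^-1; 2^-1; - 4^-1];
  [:: 0; - 2^-1; 2^-1; 4^-1]; [:: - t; t; 0; t / 2]].
pose p' := [:: [:: (2 * t)^-1; 0; 0; - (2 * t)^-1];
  [:: (4 * t)^-1; 2^-1; - 2^-1; (4 * t)^-1]; [:: 0; 1; 1; 0];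
  [:: (2 * t)^-1; -1; 1; (2 * t)^-1]].
apply: (@rows_equiv _ 2^-1 (2 * t) p p').
- by rewrite invr_eq0.
- by rewrite mulf_neq0.
- by mx_tac; field; rewrite ?n2 ?n4 ?t0.
- by mx_tac; field; rewrite ?n2 ?n4 ?t0.
- by mx_tac; field; rewrite ?n2 ?n4 ?t0.
Qed.

(** D is nilpotent with the single chain e_4, e_3, t e_5, - t e_6, and a diagonal change of basis
    absorbs t. *)
Lemma g24_5_equiv t : t != 0 ->
  rows_dext_equiv
    [:: [:: - t; 0; 0; 0]; [:: 0; 0; 1; 0]; [:: 0; 1; 0; 0]; [:: 0; 0; 0; 0]]
    [:: [:: -1; 0; 0; 0]; [:: 0; 0; 1; 0]; [:: 0; 1; 0; 0]; [:: 0; 0; 0; 0]]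
    [:: [:: 0; 0; 1; 0]; [:: 1; 0; 0; 0]; [:: 0; 0; 0; -1]; [:: 0; 0; 0; 0]].
Proof.
move=> t0.
pose p := [:: [:: t; 0; 0; 0]; [:: 0; 1; 0; 0]; [:: 0; 0; t; 0]; [:: 0; 0; 0; t ^+ 2]].
pose p' := [:: [:: t^-1; 0; 0; 0]; [:: 0; 1; 0; 0]; [:: 0; 0; t^-1; 0]; [:: 0; 0; 0; t ^- 2]].
apply: (@rows_equiv _ t t p p') => //; mx_tac; field => //.
Qed.

End Equivalences.

(** * Deformations of g_{2|4}^1 from polynomial matrices, and the jump criterion *)

Section RowDeformations.
Context {C : numFieldType}.
Implicit Types (q : seq (seq {poly C})) (s : seq (seq C)) (t u : C).

Definition poly_dext q : superalgebra {poly C} (2 + 4) :=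
  dext (mx_of_rows 4 4 q)
    (mx_of_rows 4 4 q *m map_mx polyC (mx_of_rows 4 4 (symplectic_rows C))).

(** Ties a matrix over C[t] to the lists of its values, for which the equivalences above are
    stated. *)
Definition interpolates q (qt : C -> seq (seq C)) :=
  forall t i j, (i < 4)%N -> (j < 4)%N -> (mx_entry q i j).[t] = mx_entry (qt t) i j.

Lemma eval_poly_dext q qt t : interpolates q qt ->
  eval_superalgebra t (poly_dext q) =
  dext (mx_of_rows 4 4 (qt t)) (mx_of_rows 4 4 (mul_symplectic_rows (qt t))).
Proof.
move=> qqt; rewrite /eval_superalgebra map_dext map_mxM -mul_mx_symplectic.
have -> : map_mx (horner_eval t) (mx_of_rows 4 4 q) = mx_of_rows 4 4 (qt t).
  by apply/matrixP => i j; rewrite !mxE -qqt.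
congr (dext _ (_ *m _)); apply/matrixP => i j; rewrite !mxE.
exact: hornerC.
Qed.

Definition nilpotent_q : seq (seq C) :=
  [:: [:: 0; 0; 0; 0]; [:: 0; 0; 1; 0]; [:: 0; 1; 0; 0]; [:: 0; 0; 0; 0]].

Lemma g24_1_nilpotent : g24_1 =
  dext (mx_of_rows 4 4 nilpotent_q) (mx_of_rows 4 4 (mul_symplectic_rows nilpotent_q)).
Proof.
rewrite g24_1E; congr dext; apply: eq_mx_of_rows => i j.
by case: i => [|[|[|[|i]]]] //; case: j => [|[|[|[|j]]]] // _ _; rewrite /mx_entry /= ?oppr0.
Qed.

Lemma metric_deformation_rows q qt :
  (forall i j, (i < 4)%N -> (j < 4)%N -> mx_entry q i j = mx_entry q j i) ->
  interpolates q qt -> qt 0 = nilpotent_q ->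
  metric_deformation g24_1 (poly_deformation (poly_dext q)).
Proof.
move=> qs qqt q0; rewrite g24_1_nilpotent -q0 -(eval_poly_dext 0 qqt).
apply: metric_deformation_dext; rewrite ?symplectic_trmx ?symplectic_square //.
by apply/matrixP => i j; rewrite !mxE qs.
Qed.

Lemma specialize_rows q qt t : interpolates q qt ->
  specialize g24_1 (poly_deformation (poly_dext q)) t =
  dext (mx_of_rows 4 4 (qt t)) (mx_of_rows 4 4 (mul_symplectic_rows (qt t))).
Proof. by move=> qqt; rewrite specialize_poly // (eval_poly_dext t qqt). Qed.

(* On the odd part of the nilpotent algebra ad e_2 squares to zero. *)
Lemma g24_1_not_isomorphic s d i j : (i < 4)%N -> (j < 4)%N ->
  mx_entry (mul_rows d d) i j != 0 ->
  ~ isomorphic g24_1 (dext (mx_of_rows 4 4 s) (mx_of_rows 4 4 d)).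
Proof.
move=> i4 j4 dd; rewrite g24_1_nilpotent => /isomorphic_dext[c [P [uP]]].
set D := mx_of_rows 4 4 (mul_symplectic_rows _); set D' := mx_of_rows 4 4 d => DP.
have DD : D *m D = 0.
  have -> : 0 = mx_of_rows 4 4 (scale_rows 0 (unit_rows C)).
    by rewrite -scale_mx_of_rows scale0r.
  by rewrite mul_mx_of_rows /nilpotent_q; mx_tac; ring.
have : c ^+ 2 *: (D' *m D') = 0.
  have : D *m (D *m P) = P *m (c ^+ 2 *: (D' *m D')).
    by rewrite DP -scalemxAr mulmxA DP -scalemxAl scalerA -mulmxA -scalemxAr.
  rewrite mulmxA DD mul0mx => /(congr1 (mulmx (invmx P))).
  by rewrite mulmx0 mulKmx.
move/matrixP => /(_ (Ordinal i4) (Ordinal j4)) /eqP.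
rewrite mul_mx_of_rows !mxE mulf_eq0 expf_eq0 (negPf dd) orbF /= => /eqP c0.
(* If c = 0, then D P = 0 and so D = 0, whereas D sends e_4 to e_3. *)
move: DP; rewrite c0 scale0r => /(congr1 (mulmx^~ (invmx P))).
rewrite mulmxK // mul0mx => /matrixP/(_ 1 0)/eqP.
by rewrite !mxE /mx_entry /= oner_eq0.
Qed.

Lemma near0_disk (P : C -> Prop) : (forall t, t != 0 -> `|t| < 1 -> P t) ->
  \forall t \near (0 : C)^', P t.
Proof.
move=> H; near=> t; apply: H; near: t; first exact: nbhs_dnbhs_neq.
exact: dnbhs0_lt.
Unshelve. all: by end_near. Qed.

(** The non-zero entry (i, j) of D'^2 certifies that the target differs from the undeformed
    algebra. *)
Lemma jump_rows q qt s d i j :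
  (forall i j, (i < 4)%N -> (j < 4)%N -> mx_entry q i j = mx_entry q j i) ->
  interpolates q qt -> qt 0 = nilpotent_q ->
  (forall t, t != 0 -> rows_dext_equiv (qt t) s d) ->
  (i < 4)%N -> (j < 4)%N -> mx_entry (mul_rows d d) i j != 0 ->
  has_jump_metric_deformation g24_1 (dext (mx_of_rows 4 4 s) (mx_of_rows 4 4 d)).
Proof.
move=> qs qqt q0 eqv i4 j4 dd; exists (poly_deformation (poly_dext q)).
split; first exact: metric_deformation_rows qqt q0.
split; first exact: convergent_poly.
- apply: near0_disk => t t0 _.
  by rewrite (specialize_rows t qqt); apply/dext_equiv_isomorphic/eqv.
- exact: g24_1_not_isomorphic dd.
Qed.

End RowDeformations.

(** * Trace invariants and the criterion for smooth deformations *)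

Lemma mxtrace_conj (K : fieldType) n (D P D' : 'M[K]_n) c :
  P \in unitmx -> D *m P = c *: (P *m D') -> \tr D = c * \tr D'.
Proof.
move=> uP DP; have -> : D = c *: (P *m D' *m invmx P) by rewrite scalemxAl -DP mulmxK.
by rewrite mxtraceZ mxtrace_mulC mulmxA mulVmx // mul1mx.
Qed.

Lemma mulmx_conj (K : fieldType) n (D P D' : 'M[K]_n) c :
  D *m P = c *: (P *m D') -> (D *m D) *m P = c ^+ 2 *: (P *m (D' *m D')).
Proof.
by move=> DP; rewrite -mulmxA DP -scalemxAr [D *m _]mulmxA DP -scalemxAl scalerA -mulmxA.
Qed.

Lemma mxtrace_rows (K : comNzRingType) (s : seq (seq K)) :
  \tr (mx_of_rows 4 4 s) =
  mx_entry s 0 0 + mx_entry s 1 1 + mx_entry s 2 2 + mx_entry s 3 3.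
Proof. by rewrite /mxtrace !big_ord_recl big_ord0 !mxE addr0 !addrA. Qed.

Section Smooth.
Context {C : numFieldType}.
Implicit Types (a b : {poly C}) (t u : C).

Local Notation lower_dext x y := (dext (mx_of_rows 4 4 (lower_q x y))
  (mx_of_rows 4 4 (mul_symplectic_rows (lower_q x y)))).

(* The eigenvalues x, y, -x, -y of ad e_2 are an invariant up to a common
   scalar, read off the traces of its square and of its fourth power. *)
Lemma lower_isomorphic (x y x' y' : C) :
  isomorphic (lower_dext x y) (lower_dext x' y') ->
  (x ^+ 2 * y' ^+ 2 - x' ^+ 2 * y ^+ 2) * (x ^+ 2 * x' ^+ 2 - y ^+ 2 * y' ^+ 2) = 0.
Proof.
move=> /isomorphic_dext[c [P [uP /mulmx_conj DP]]].
have := mxtrace_conj uP (mulmx_conj DP); have := mxtrace_conj uP DP.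
rewrite !mul_mx_of_rows !mxtrace_rows /lower_q /mul_rows /mul_symplectic_rows /mx_entry /=.
rewrite !(mul0r, mulr0, addr0, add0r, mulrNN, mulr1, mulNr, mulrN, opprK, oppr0) => e2 e4.
have n2 : (2 : C) != 0 by rewrite pnatr_eq0.
have {}e2 : x ^+ 2 + y ^+ 2 = c ^+ 2 * (x' ^+ 2 + y' ^+ 2).
  apply: (mulfI n2); transitivity (x * x + y * y + x * x + y * y); first by ring.
  by rewrite e2; ring.
have {}e4 : x ^+ 4 + y ^+ 4 = c ^+ 4 * (x' ^+ 4 + y' ^+ 4).
  apply: (mulfI n2).
  transitivity (x * x * (x * x) + y * y * (y * y) + x * x * (x * x) + y * y * (y * y)); first by ring.
  by rewrite e4; ring.
(* The elementary symmetric function of x^2 and y^2 is recovered from their power sums. *)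
have e22 : x ^+ 2 * y ^+ 2 = c ^+ 4 * (x' ^+ 2 * y' ^+ 2).
  apply: (mulfI n2); transitivity ((x ^+ 2 + y ^+ 2) ^+ 2 - (x ^+ 4 + y ^+ 4)); first by ring.
  by rewrite e2 e4; ring.
(* The claimed product expands to x'^2 y'^2 (x^4 + y^4) - x^2 y^2 (x'^4 + y'^4), in which the
   unprimed symmetric functions are c^4 times the primed ones. *)
have [c0|c0] := eqVneq c 0.
  move: e4 e22; rewrite c0 expr0n /= !mul0r => e4 e22.
  transitivity (x' ^+ 2 * y' ^+ 2 * (x ^+ 4 + y ^+ 4) - (x ^+ 2 * y ^+ 2) * (x' ^+ 4 + y' ^+ 4)).
    by ring.
  by rewrite e4 e22 mulr0 mul0r subr0.
have c4 : c ^+ 4 != 0 by rewrite expf_neq0.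
transitivity (x' ^+ 2 * y' ^+ 2 * (x ^+ 4 + y ^+ 4) - (x ^+ 2 * y ^+ 2) * (x' ^+ 4 + y' ^+ 4)).
  by ring.
by rewrite e4 e22; ring.
Qed.

Lemma lower_dext_family (x y : C) : x != 0 -> x != y ->
  isomorphic (lower_dext x y) (g24_3 (y / x)).
Proof.
by move=> x0 xy; rewrite g24_3E; apply/dext_equiv_isomorphic/lower_diag_equiv.
Qed.

Definition lower_poly a b : seq (seq {poly C}) :=
  [:: [:: 0; 0; a; 0]; [:: 0; 0; 1; b]; [:: a; 1; 0; 0]; [:: 0; b; 0; 0]].

Lemma interpolates_lower a b : interpolates (lower_poly a b) (fun t => lower_q a.[t] b.[t]).
Proof.
move=> t i j; case: i => [|[|[|[|i]]]] //; case: j => [|[|[|[|j]]]] // _ _;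
  by rewrite /mx_entry /= ?hornerE.
Qed.

Lemma lower_poly_sym a b i j : (i < 4)%N -> (j < 4)%N ->
  mx_entry (lower_poly a b) i j = mx_entry (lower_poly a b) j i.
Proof. by case: i => [|[|[|[|i]]]] //; case: j => [|[|[|[|j]]]]. Qed.

(** By [lower_isomorphic], members t and u can be isomorphic only if the left side of the polynomial
    identity vanishes. In the punctured unit disk the factored form leaves u = t and u = - t, and
    the last hypothesis makes t -> - t a symmetry. *)
Lemma smooth_rows a b (lam : C -> C) lam0 kappa :
  a.[0] = 0 -> b.[0] = 0 ->
  (forall t, t != 0 -> `|t| < 1 ->
    [/\ a.[t] != 0, a.[t] != b.[t] & b.[t] / a.[t] = lam t]) ->
  lam t @[t --> (0 : C)^'] --> lam0 ->
  kappa != 0 ->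
  (forall t u, (a.[t] ^+ 2 * b.[u] ^+ 2 - a.[u] ^+ 2 * b.[t] ^+ 2) *
    (a.[t] ^+ 2 * a.[u] ^+ 2 - b.[t] ^+ 2 * b.[u] ^+ 2) =
    kappa * (t * u) ^+ 4 * (t ^+ 2 - u ^+ 2) * (1 - (t * u) ^+ 2)) ->
  (forall t, t != 0 -> `|t| < 1 ->
    dext_equiv (mx_of_rows 4 4 (diag_q (lam (- t)))) (mx_of_rows 4 4 (diag_d (lam (- t))))
      (mx_of_rows 4 4 (diag_q (lam t))) (mx_of_rows 4 4 (diag_d (lam t)))) ->
  has_smooth_metric_deformation g24_1 g24_3 lam0.
Proof.
move=> a0 b0 ab laml k0 kE lamN.
have qqt := interpolates_lower a b.
exists (poly_deformation (poly_dext (lower_poly a b))); split.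
  by apply: (metric_deformation_rows (@lower_poly_sym a b) qqt); rewrite a0 b0.
have spE t := specialize_rows t qqt.
split; last first.
  exists lam; split=> //; apply: near0_disk => t t0 t1; rewrite spE.
  by have [at0 abt <-] := ab t t0 t1; apply: lower_dext_family.
split; first exact: convergent_poly.
exists 1%N, (fun _ t => - t); split=> [_|].
  split; rewrite ?oppr0 //.
  - by near=> t; exact/derivableN/derivable_id.
  - rewrite derive1E deriveN ?derive_id ?oppr_eq0 ?oner_eq0 //; exact: derivable_id.
  - apply: near0_disk => t t0 t1; rewrite !spE; apply: dext_equiv_isomorphic.
    have [at0 abt abl] := ab t t0 t1.
    have [aNt0 abNt abNl] : [/\ a.[- t] != 0, a.[- t] != b.[- t] & b.[- t] / a.[- t] = lam (- t)].
      by apply: ab; rewrite ?oppr_eq0 ?normrN.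
    (* Both members are brought to diagonal form and compared there. *)
    apply: (dext_equiv_trans (lower_diag_equiv aNt0 abNt)); rewrite abNl.
    apply: (dext_equiv_trans (lamN t t0 t1)); apply: dext_equiv_sym.
    by rewrite -abl; apply: lower_diag_equiv.
exists ([set t | t != 0 /\ `|t| < 1], [set t | t != 0 /\ `|t| < 1]).
  by split; apply: near0_disk.
move=> [t u] /= [[t0 t1] [u0 u1]]; rewrite !spE => /lower_isomorphic; rewrite kE.
move/eqP; rewrite 3!mulf_eq0 (negPf k0) expf_eq0 mulf_eq0 (negPf t0) (negPf u0) /= => /orP[].
  by rewrite subr_eq0 eqf_sqr => /orP[/eqP ->|/eqP ->]; [left|right; exists 0; rewrite opprK].
(* The remaining factor would give (t u)^2 = 1, against |t u| < 1. *)
rewrite subr_eq0 => /eqP/(congr1 Num.norm)/eqP; rewrite normr1 normrX normrM eq_sym.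
by rewrite lt_eqF // exprn_ilt1 // ?mulr_ge0 // mulr_ilt1.
Unshelve. all: by end_near. Qed.

(** * The individual jump and smooth deformations *)

Lemma jump_lower (b : {poly C}) (s d : seq (seq C)) i j : b.[0] = 0 ->
  (forall t, t != 0 -> rows_dext_equiv (lower_q t b.[t]) s d) ->
  (i < 4)%N -> (j < 4)%N -> mx_entry (mul_rows d d) i j != 0 ->
  has_jump_metric_deformation g24_1 (dext (mx_of_rows 4 4 s) (mx_of_rows 4 4 d)).
Proof.
move=> b0 eqv; apply: (jump_rows (@lower_poly_sym 'X b) (interpolates_lower 'X b)).
  by rewrite hornerX b0.
by move=> t t0; rewrite hornerX; apply: eqv.
Qed.

(** With b = 0 the deformed algebra is [g24_3 0], which is this direct sum up to the order of the
    basis. *)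
Lemma jump_direct_sum :
  has_jump_metric_deformation (g24_1 (C:=C)) (direct_sum g22_2 (abelian 0 2)).
Proof.
rewrite direct_sum_g22_2E; apply: (@jump_lower 0 _ _ 0 0) => //.
- by rewrite horner0.
- move=> t t0; apply: dext_equiv_trans diag0_sum_equiv.
  by have := lower_diag_equiv t0 t0; rewrite mul0r horner0.
- by rewrite /mx_entry /= !mul0r !addr0 mulr1 oner_eq0.
Qed.

Lemma jump_g24_2 : has_jump_metric_deformation (g24_1 (C:=C)) g24_2.
Proof.
rewrite g24_2E; pose q : seq (seq {poly C}) :=
  [:: [:: 2 * 'X ^+ 2; 0; 0; 2 * 'X ^+ 2]; [:: 0; 0; 1; 0]; [:: 0; 1; 0; 0];
      [:: 2 * 'X ^+ 2; 0; 0; 2 * 'X ^+ 2]].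
apply: (@jump_rows _ q _ _ _ 1 1 _ _ _ (@g24_2_equiv C)) => //.
- by move=> i j; case: i => [|[|[|[|i]]]] //; case: j => [|[|[|[|j]]]].
- move=> t i j; case: i => [|[|[|[|i]]]] //; case: j => [|[|[|[|j]]]] // _ _;
    by rewrite /mx_entry /= ?hornerE.
- by rewrite expr0n /= mulr0.
- by rewrite /mx_entry /= !mul0r !addr0 add0r mulr1 oner_eq0.
Qed.

Lemma jump_g24_3_1 : has_jump_metric_deformation (g24_1 (C:=C)) (g24_3 1).
Proof.
rewrite g24_3E; pose q : seq (seq {poly C}) :=
  [:: [:: 0; 0; 0; 'X ^+ 2]; [:: 0; 0; 1; 0]; [:: 0; 1; 0; 0]; [:: 'X ^+ 2; 0; 0; 0]].
apply: (@jump_rows _ q _ _ _ 0 0 _ _ _ (@swap_diag_equiv C)) => //.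
- by move=> i j; case: i => [|[|[|[|i]]]] //; case: j => [|[|[|[|j]]]].
- move=> t i j; case: i => [|[|[|[|i]]]] //; case: j => [|[|[|[|j]]]] // _ _;
    by rewrite /mx_entry /= ?hornerE.
- by rewrite expr0n.
- by rewrite /mx_entry /= !mul0r !addr0 mulr1 oner_eq0.
Qed.

(** Along b = l a the parameter b / a is constant, and l different from 1 keeps a and b distinct. *)
Lemma jump_g24_3 (l : C) : l != 1 -> has_jump_metric_deformation g24_1 (g24_3 l).
Proof.
move=> l1; rewrite g24_3E; apply: (@jump_lower (l *: 'X) _ _ 0 0) => //.
- by rewrite !hornerE.
- move=> t t0; have tl : t != l * t by rewrite -subr_eq0 -{1}[t]mul1r -mulrBl mulf_neq0 // subr_eq0 eq_sym.
  by have := lower_diag_equiv t0 tl; rewrite mulfK // !hornerE.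
- by rewrite /mx_entry /= !mul0r !addr0 mulr1 oner_eq0.
Qed.

Lemma jump_g24_4 : has_jump_metric_deformation (g24_1 (C:=C)) g24_4.
Proof.
rewrite g24_4E; apply: (@jump_lower 'X _ _ 0 0) => //.
- by rewrite hornerX.
- by move=> t t0; rewrite hornerX; apply: lower_g24_4_equiv.
- by rewrite /mx_entry /= !mul0r !addr0 mulr1 oner_eq0.
Qed.

Lemma jump_g24_5 : has_jump_metric_deformation (g24_1 (C:=C)) g24_5.
Proof.
rewrite g24_5E; pose q : seq (seq {poly C}) :=
  [:: [:: - 'X; 0; 0; 0]; [:: 0; 0; 1; 0]; [:: 0; 1; 0; 0]; [:: 0; 0; 0; 0]].
(* Here ad e_2 is itself nilpotent, but its square still sends e_4 to e_5. *)
apply: (@jump_rows _ q _ _ _ 1 2 _ _ _ (@g24_5_equiv C)) => //.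
- by move=> i j; case: i => [|[|[|[|i]]]] //; case: j => [|[|[|[|j]]]].
- move=> t i j; case: i => [|[|[|[|i]]]] //; case: j => [|[|[|[|j]]]] // _ _;
    by rewrite /mx_entry /= ?hornerE.
- by rewrite oppr0.
- by rewrite /mx_entry /= !mul0r !addr0 mulr1 oner_eq0.
Qed.

(** With a = t and b = t^2 the parameter is t itself, and t -> - t is the symmetry given by
    [diag_opp_equiv]. *)
Lemma smooth_g24_3_0 : has_smooth_metric_deformation (g24_1 (C:=C)) g24_3 0.
Proof.
apply: (@smooth_rows 'X ('X ^+ 2) id 0 (-1)); rewrite ?hornerE ?expr0n ?oppr_eq0 ?oner_eq0 //.
- move=> t t0 t1; rewrite !hornerE; split=> //; last by rewrite expr2 mulfK.
  rewrite -{1}[t]mulr1 expr2 (inj_eq (mulfI t0)).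
  by apply: contraTneq t1 => <-; rewrite normr1 ltxx.
- exact: cvg_within.
- by move=> t u; rewrite !(hornerX, hornerXn); ring.
- by move=> t _ _; apply: diag_opp_equiv.
Qed.

Lemma cvg_homography (k : C) (F : set_system C) {FF : Filter F} : t @[t --> F] --> (0 : C) ->
  k * (1 - t) / (1 + t) @[t --> F] --> k.
Proof.
move=> F0; have kE : k * (1 - 0) / (1 + 0) = k by rewrite subr0 addr0 divr1 mulr1.
rewrite -[in X in _ --> X]kE; apply: cvgM.
  by apply: cvgM; [exact: cvg_cst|apply: cvgB => //; exact: cvg_cst].
apply: cvgV; first by rewrite addr0 oner_neq0.
by apply: cvgD => //; exact: cvg_cst.
Qed.

(** The parameter k (1 - t) / (1 + t) tends to k, and t -> - t turns it from l into k^2 / l. As k^2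
    is 1 or -1, this gives an isomorphic member by inversion and, if needed, a change of sign. The
    second hypothesis keeps a and b distinct. *)
Lemma smooth_g24_3 (k : C) : k ^+ 4 = 1 ->
  (forall t, t != 0 -> `|t| < 1 -> 1 + t != k * (1 - t)) ->
  (forall l, dext_equiv
    (mx_of_rows 4 4 (diag_q (k ^+ 2 / l))) (mx_of_rows 4 4 (diag_d (k ^+ 2 / l)))
    (mx_of_rows 4 4 (diag_q l^-1)) (mx_of_rows 4 4 (diag_d l^-1))) ->
  has_smooth_metric_deformation g24_1 g24_3 k.
Proof.
move=> k4 kt k2; have k0 : k != 0 by apply: contraTneq (oner_neq0 C) => k0; rewrite -k4 k0 expr0n eqxx.
have d0 t : `|t| < 1 -> 1 + t != 0.
  by apply: contraTneq => /eqP; rewrite addrC addr_eq0 => /eqP ->; rewrite normrN1 ltxx.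
pose hE := (@hornerZ C, @hornerM C, @hornerD C, @hornerN C, @hornerX C, @hornerC C).
apply: (@smooth_rows ('X * (1%:P + 'X)) (k *: ('X * (1%:P - 'X))) (fun t => k * (1 - t) / (1 + t)) k
  (16 * k ^+ 2)).
- by rewrite !hE mul0r ?mulr0.
- by rewrite !hE mul0r ?mulr0.
- move=> t t0 t1; rewrite !hE; have dt := d0 t t1.
  split; first by rewrite mulf_neq0.
    by rewrite mulrCA (inj_eq (mulfI t0)) kt.
  by field; rewrite t0 dt.
- have H : t @[t --> (0 : C)^'] --> (0 : C) by exact: cvg_within.
  exact: (@cvg_homography k (0 : C)^' _ H).
- by rewrite mulf_neq0 ?expf_neq0 // pnatr_eq0.
- move=> t u; rewrite !hE.
  (* The two sides differ by a multiple of 1 - k^4. *)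
  transitivity (16 * k ^+ 2 * (t * u) ^+ 4 * (t ^+ 2 - u ^+ 2) * (1 - (t * u) ^+ 2) +
    (1 - k ^+ 4) * (k ^+ 2 * (t * u) ^+ 4 *
      ((1 - u) ^+ 2 * (1 + t) ^+ 2 - (1 + u) ^+ 2 * (1 - t) ^+ 2) *
      ((1 - t) * (1 - u)) ^+ 2)); first by ring.
  by rewrite k4 subrr mul0r addr0.
- move=> t t0 t1; have dt := d0 t t1.
  have dt' : 1 - t != 0 by apply: d0; rewrite normrN.
  have l0 : k * (1 - t) / (1 + t) != 0 by rewrite !mulf_neq0 ?invr_eq0.
  have -> : k * (1 - - t) / (1 + - t) = k ^+ 2 / (k * (1 - t) / (1 + t)).
    by field; rewrite k0 dt dt'.
  apply: dext_equiv_trans (k2 _) _; apply: dext_equiv_sym; exact: diag_inv_equiv.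
Qed.

End Smooth.

Local Close Scope classical_set_scope.

Theorem theorem3p4p1 (R : realType) :
  let C : numClosedFieldType := R[i] in
  let g1 : superalgebra C 6 := g24_1 in
  [/\ has_jump_metric_deformation g1 (direct_sum g22_2 (abelian 0 2)),
      has_jump_metric_deformation g1 g24_2,
      has_jump_metric_deformation g1 (g24_3 1),
      has_jump_metric_deformation g1 (g24_3 'i) &
      has_jump_metric_deformation g1 g24_4] /\
  [/\ has_jump_metric_deformation g1 g24_5,
      has_smooth_metric_deformation g1 g24_3 0,
      has_smooth_metric_deformation g1 g24_3 1 &
      has_smooth_metric_deformation g1 g24_3 'i].
Proof.
split; split.
- exact: jump_direct_sum.
- exact: jump_g24_2.
- exact: jump_g24_3_1.
- apply: jump_g24_3; apply/eqP => i1; have := sqrCi (R[i] : numClosedFieldType).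
  by rewrite i1 expr1n => /eqP; rewrite -subr_eq0 opprK -mulr2n pnatr_eq0.
- exact: jump_g24_4.
- exact: jump_g24_5.
- exact: smooth_g24_3_0.
- apply: smooth_g24_3; first by rewrite expr1n.
    move=> t t0 _; rewrite mul1r (inj_eq (addrI _)) -subr_eq0 opprK -mulr2n.
    by rewrite mulrn_eq0.
  move=> l; rewrite expr1n mul1r.
  by exists 1, 1, 1%:M; split; rewrite ?oner_neq0 ?unitmx1 // !scale1r ?mulmx1 ?mul1mx ?trmx1 ?mulmx1.
- have i2 := sqrCi (R[i] : numClosedFieldType).
  apply: smooth_g24_3.
  + by rewrite (exprM _ 2 2) i2 sqrrN expr1n.
  + move=> t t0 t1; apply/eqP => ti.
    (* The equation 1 + t = i (1 - t) forces t = i, which has norm 1 and so lies outside the open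
       disk. *)
    have : 2 * t - 2 * 'i = 0.
      transitivity ((1 - 'i) * ((1 + t) - 'i * (1 - t)) - ('i ^+ 2 + 1) * (1 - t)); first by ring.
      by rewrite ti i2 subrr addNr mulr0 mul0r subr0.
    move/eqP; rewrite -mulrBr mulf_eq0 pnatr_eq0 /= subr_eq0 => /eqP ti'.
    by move: t1; rewrite ti' normCi ltxx.
  + by move=> l; rewrite i2 mulN1r; apply: diag_opp_equiv.
Qed.
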